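(* Let $n \ge 1$ and let $K \subset \mathbb{R}^n$ be a symmetric convex body. Then for every Orlicz function $\psi$, $$\frac{2}{(n+1)^{1/n}}\,\|U_K\|_\psi^{1/n} \le \|V_K\|_\psi^{1/n} \le 2\,\|U_K\|_\psi^{1/n}.$$ In particular, for every $1 \le p \le \infty$, $$\frac{2}{(n+1)^{1/n}}\,\|U_K\|_p^{1/n} \le \|V_K\|_p^{1/n} \le 2\,\|U_K\|_p^{1/n}.$$
   Context: A convex body in $\mathbb{R}^n$ is a compact convex set with nonempty interior; it is symmetric if $K = -K$. $|A|$ denotes the volume ($n$-dimensional Lebesgue measure) of a Borel set $A \subset \mathbb{R}^n$. For a symmetric convex body $K \subset \mathbb{R}^n$, $U_K$ and $V_K$ are the random variables $$U_K = \frac{1}{|K|}\,\bigl|\mathrm{conv}\{x_1,\ldots,x_{n+1}\}\bigr|, \qquad V_K = \frac{1}{|K|}\,\bigl|\mathrm{conv}\{\pm x_1,\ldots,\pm x_n\}\bigr|,$$ where in each case the $x_i$ are independent random points uniformly distributed in $K$. An Orlicz function is a continuous, increasing, convex function $\psi : [0,\infty) \to [0,\infty)$ with $\psi(0) = 0$ and $\lim_{t\to\infty}\psi(t) = \infty$. The corresponding Orlicz norm of a random variable $X$ is $$\|X\|_\psi = \inf\left\{\rho > 0 : \mathbb{E}\,\psi\left(\frac{|X|}{\rho}\right) \le 1\right\}.$$ For $1 \le p < \infty$, $\|X\|_p = (\mathbb{E}|X|^p)^{1/p}$, and $\|X\|_\infty$ is the essential supremum of $|X|$. *)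

(* Defs.v *)
From HB Require Import structures.
From mathcomp Require Import all_boot all_order all_algebra.
From mathcomp Require Import all_classical all_reals all_analysis.
From mathcomp Require Import measurable_realfun.

Set Implicit Arguments.
Unset Strict Implicit.
Unset Printing Implicit Defensive.

Import Order.TTheory GRing.Theory Num.Theory.
Import numFieldNormedType.Exports.

Local Open Scope classical_set_scope.
Local Open Scope ring_scope.

(* Matrices, in particular the row vectors 'rV[R]_n representing R^n, carry   *)
(* their Borel sigma-algebra.                                                 *)
HB.instance Definition _ (R : realType) (m n : nat) :=
  @isMeasurable.Build (sigma_display (@open 'M[R]_(m, n))) 'M[R]_(m, n)
    <<s @open 'M[R]_(m, n) >> (@sigma_algebra0 _ setT _)
    (@sigma_algebraC _ _) (@sigma_algebra_bigcup _ setT _).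

(* n-dimensional Lebesgue measure on Borel sets, as the iterated product of   *)
(* the one-dimensional one. It is shown below to be a sigma-finite measure    *)
(* which gives boxes their usual volume; its values on non-Borel sets are     *)
(* meaningless.                                                               *)
Fixpoint lebesgue_rV (R : realType) (n : nat) : set 'rV[R]_n -> \bar R :=
  match n with
  | 0 => fun A => (\1_A 0)%:E
  | m.+1 => fun A => (\int[lebesgue_measure]_x
      lebesgue_rV [set v : 'rV[R]_m | A (row_mx (x%:M : 'rV[R]_1) v)])%E
  end.
Arguments lebesgue_rV {R n} A : simpl never.

Lemma open_rV_bigcup (R : realType) (n : nat) (O : set 'rV[R]_n) : open O ->
  O = \bigcup_(c in [set c : 'rV[rat]_n * nat |
        ball (map_mx ratr c.1 : 'rV[R]_n) c.2.+1%:R^-1 `<=` O])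
      ball (map_mx ratr c.1 : 'rV[R]_n) c.2.+1%:R^-1.
Proof.
move=> oO; apply/seteqP; split => [x Ox|x [c cO /cO]//].
have /nbhs_ballP[e /= e0 eO] := open_nbhs_nbhs (conj oO Ox).
have [k _ /(_ k (leqnn _)) ke] :=
  near_infty_natSinv_lt (PosNum (divr_gt0 e0 (ltr0n _ 2))).
have k0 : 0 < k.+1%:R^-1 :> R by rewrite invr_gt0.
have /choice[q qx] i : exists q : rat,
    ball (x 0 i) k.+1%:R^-1 (ratr q).
  have /rat_in_itvoo[q] : x 0 i - k.+1%:R^-1 < x 0 i + k.+1%:R^-1 :> R.
    by rewrite ltrD2l gtrN.
  by rewrite in_itv/= => qx; exists q; rewrite /ball/= ltr_distlC.
have xq : ball x k.+1%:R^-1 (map_mx ratr (\row_i q i) : 'rV[R]_n).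
  split => // i j; rewrite !mxE ord1; exact: qx.
exists (\row_i q i, k) => /=; last exact: ball_sym.
move=> y qy; apply: eO; apply: (@le_ball _ _ _ (k.+1%:R^-1 + k.+1%:R^-1)).
  by rewrite [leRHS]splitr; apply: lerD; exact: ltW.
exact: ball_triangle qy.
Qed.

Lemma measurable_rV_cons (R : realType) (n : nat) :
  measurable_fun [set: measurableTypeR R * 'rV[R]_n]
    (fun p => row_mx p.1%:M p.2 : 'rV[R]_n.+1).
Proof.
apply: (measurability (@open 'rV[R]_n.+1)) => // _ [ O oO <-].
rewrite setTI (open_rV_bigcup oO) preimage_bigcup bigcup_mkcond.
apply: countable_bigcupT_measurable => // -[q k].
case: ifPn => // _.
pose q' : 'rV[rat]_(1 + n) := q.
have -> : (fun p : R * 'rV[R]_n => row_mx p.1%:M p.2 : 'rV[R]_n.+1) @^-1`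
    ball (map_mx ratr (q, k).1 : 'rV[R]_n.+1) ((q, k).2.+1%:R^-1 : R) =
    ball (ratr (q' 0 (@lshift 1 n 0)) : R) (k.+1%:R^-1 : R) `*`
    ball (map_mx ratr (rsubmx q') : 'rV[R]_n) k.+1%:R^-1.
  have k0 : 0 < k.+1%:R^-1 :> R by rewrite invr_gt0.
  apply/seteqP; split => [[x v] [_ /= qxv]|[x v] [/= qx [_ qv]]].
    split => /=; last split => // i j.
      have := qxv 0 (@lshift 1 n 0).
      by rewrite (@row_mxEl R 1 1 n x%:M v) !mxE.
    have := qxv 0 (@rshift 1 n j).
    by rewrite (@row_mxEr R 1 1 n x%:M v) !mxE ord1.
  split => //= i j; rewrite ord1 -[j](@splitK 1 n).
  case: (fintype.split (j : 'I_(1 + n))) => /= a.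
    by rewrite (@row_mxEl R 1 1 n x%:M v) !mxE ord1.
  rewrite (@row_mxEr R 1 1 n x%:M v) mxE.
  by have := qv 0 a; rewrite !mxE.
apply: measurableX; first by apply: open_measurable; exact: ball_open.
apply: sub_sigma_algebra; exact: ball_open.
Qed.

Section lebesgue_rV_measure.
Local Open Scope ereal_scope.
Variable R : realType.

Lemma lebesgue_rVS n (A : set 'rV[R]_n.+1) :
  lebesgue_rV A = \int[lebesgue_measure]_x
    lebesgue_rV [set v : 'rV[R]_n | A (row_mx (x%:M : 'rV[R]_1) v)].
Proof. by []. Qed.

Lemma lebesgue_rV_ge0 n (A : set 'rV[R]_n) : 0 <= lebesgue_rV A.
Proof.
elim: n A => [|n IH] A; first by rewrite /lebesgue_rV/= lee_fin.
by rewrite lebesgue_rVS; apply: integral_ge0 => x _; exact: IH.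
Qed.

Lemma lebesgue_rV0 n : lebesgue_rV (@set0 'rV[R]_n) = 0.
Proof.
elim: n => [|n IH]; first by rewrite /lebesgue_rV/= indic0.
by rewrite lebesgue_rVS (eq_integral (cst 0)) ?integral0// => x _; exact: IH.
Qed.

Lemma lebesgue_rV_box n (a b : 'rV[R]_n) : (forall i, a 0 i <= b 0 i)%R ->
  lebesgue_rV [set v : 'rV[R]_n | forall i, a 0%R i <= v 0%R i <= b 0%R i]%R =
  (\prod_i (b 0 i - a 0 i))%:E.
Proof.
elim: n a b => [|n IH] a b ab.
  by rewrite big_ord0 /lebesgue_rV/= indicE mem_set// => -[].
rewrite lebesgue_rVS.
pose a' := rsubmx (a : 'rV_(1 + n)); pose b' := rsubmx (b : 'rV_(1 + n)).
rewrite (eq_integral (fun x : measurableTypeR R => (\prod_i (b' 0 i - a' 0 i))%:E *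
    (\1_(`[a 0%R ord0, b 0%R ord0]) x)%:E)); last first.
  move=> x _; rewrite indicE; case: (boolP (x \in _)) => [|].
    rewrite inE/= in_itv/= => axb.
    rewrite mule1 -IH; last by move=> i; rewrite !mxE; exact: ab.
    congr lebesgue_rV; apply/seteqP; split => v/= H i.
      have := H (@rshift 1 n i); rewrite (@row_mxEr R 1 1 n x%:M v) !mxE.
      by [].
    rewrite -[i](@splitK 1 n); case: (fintype.split (i : 'I_(1 + n))) => /= j.
      rewrite (@row_mxEl R 1 1 n x%:M v) !mxE !ord1 eqxx mulr1n.
      suff -> : @lshift 1 n 0%R = ord0 by [].
      exact: val_inj.
    by rewrite (@row_mxEr R 1 1 n x%:M v); have := H j; rewrite !mxE.
  rewrite notin_setE/= in_itv/= => axb; rewrite mule0.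
  rewrite (_ : [set _ | _] = set0) ?lebesgue_rV0//.
  apply/seteqP; split => // v /(_ ord0); rewrite (_ : ord0 = @lshift 1 n 0%R).
    rewrite (@row_mxEl R 1 1 n x%:M v) !mxE eqxx mulr1n => xx; apply: axb.
    by rewrite (_ : ord0 = @lshift 1 n 0%R)//; exact: val_inj.
  exact: val_inj.
have P0 : (0 <= \prod_i (b' 0 i - a' 0 i))%R.
  by apply: prodr_ge0 => i _; rewrite !mxE subr_ge0.
rewrite ge0_integralZl//; last first.
  apply/measurable_EFinP; exact: measurable_indic.
rewrite integral_indic// setIT.
have E := lebesgue_measure_itv `[a 0%R ord0, b 0%R ord0]; rewrite [X in _ * X = _]E {E} /= lte_fin.
rewrite big_ord_recl mulrC.
have -> : (\prod_(i < n) (b 0 (lift ord0 i) - a 0 (lift ord0 i)) =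
  \prod_i (b' 0 i - a' 0 i))%R.
  apply: eq_bigr => i _; rewrite !mxE.
  by rewrite (_ : lift ord0 i = @rshift 1 n i)//; exact: val_inj.
case: ltgtP (ab ord0) => [ba _|//|-> _]; first by rewrite -EFinD -EFinM.
by rewrite subrr mule0 mulr0.
Qed.

Lemma lebesgue_rV_sigma_finite n : sigma_finite setT (@lebesgue_rV R n).
Proof.
exists (fun k => [set v : 'rV[R]_n | forall i, - k%:R <= v 0 i <= k%:R]%R).
  apply/seteqP; split => // v _.
  exists (Num.bound `|v|) => // i; rewrite -ler_norml.
  apply: le_trans (ltW (archi_boundP (normr_ge0 v))).
  rewrite [leRHS]mx_normrE.
  by apply: le_trans (le_bigmax _ _ (0%R, i)).
move=> k; split.
  rewrite -[X in measurable X]setCK; apply: measurableC.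
  apply: sub_sigma_algebra; apply: closed_openC.
  rewrite (_ : [set _ | _] = \bigcap_i
      ((fun v : 'rV[R]_n => v 0%R i) @^-1` (`[- k%:R, k%:R]%classic : set R)%R)); last first.
    apply/seteqP; split => v /= H i.
      by move=> _; rewrite /= in_itv/=; exact: H.
    by have := H i I; rewrite /= in_itv/=.
  apply: closed_bigI => i _; apply: closed_comp => [v _|]; last exact: interval_closed.
  exact: coord_continuous.
have := @lebesgue_rV_box n (const_mx (- k%:R)%R) (const_mx k%:R%R).
rewrite (_ : [set v | _] = [set v : 'rV[R]_n | forall i, - k%:R <= v 0%R i <= k%:R]%R).
  move=> ->; first exact: ltry.
  by move=> i; rewrite !mxE ge0_cp.
by apply/seteqP; split => v /= H i; have := H i; rewrite !mxE.
Qed.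

Lemma lebesgue_rV_semi_sigma_additive n :
  semi_sigma_additive (@lebesgue_rV R n).
Proof.
elim: n => [|n IH].
  have -> : @lebesgue_rV R 0 = \d_(0%R : 'rV[R]_0) by apply/funext.
  exact: measure_semi_sigma_additive.
pose m0 : {measure set 'rV[R]_n -> \bar R} := HB.pack (@lebesgue_rV R n)
  (@isMeasure.Build _ 'rV[R]_n R (@lebesgue_rV R n)
    (@lebesgue_rV0 n) (@lebesgue_rV_ge0 n) IH).
pose m : {sigma_finite_measure set 'rV[R]_n -> \bar R} :=
  HB.pack (@lebesgue_rV R n) (Measure.class m0) (@Measure_isSigmaFinite.Build _ 'rV[R]_n R m0
    (@lebesgue_rV_sigma_finite n)).
have mE : @lebesgue_rV R n.+1 =
    pushforward (lebesgue_measure \x m)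
      (fun p => row_mx p.1%:M p.2 : 'rV[R]_n.+1).
  apply/funext => A; rewrite lebesgue_rVS; apply: eq_integral => x _ /=.
  by congr lebesgue_rV; apply/seteqP; split => v; rewrite /xsection/= inE.
rewrite mE.
pose f : {mfun (measurableTypeR R * 'rV[R]_n)%type >-> 'rV[R]_n.+1} :=
  HB.pack (fun p : R * 'rV[R]_n => row_mx p.1%:M p.2 : 'rV[R]_n.+1)
   (@isMeasurableFun.Build _ _ _ _ _ (@measurable_rV_cons R n)).
exact: (@measure_semi_sigma_additive _ _ _ (pushforward (lebesgue_measure \x m) f)).
Qed.

HB.instance Definition _ n := isMeasure.Build _ 'rV[R]_n R lebesgue_rV
  (@lebesgue_rV0 n) (@lebesgue_rV_ge0 n) (@lebesgue_rV_semi_sigma_additive n).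

HB.instance Definition _ n := Measure_isSigmaFinite.Build _ 'rV[R]_n R
  lebesgue_rV (@lebesgue_rV_sigma_finite n).

End lebesgue_rV_measure.

Definition convex_body (R : realType) (n : nat) (K : set 'rV[R]_n) : Prop :=
  [/\ convex_set (K : set (convex_lmodType 'rV[R]_n)), compact K & K° !=set0].

Definition symmetric_set (R : realType) (n : nat) (K : set 'rV[R]_n) : Prop :=
  [set - x | x in K] = K.

Definition conv_hull (R : realType) (n : nat) (A : set 'rV[R]_n) :
  set 'rV[R]_n := smallest (@convex_set R 'rV[R]_n) A.

Definition mutually_independent d d' (T : measurableType d)
    (T' : measurableType d') (R : realType) (P : probability T R)
    (I : finType) (X : I -> {RV P >-> T'}) : Prop :=
  forall (J : {set I}) (A : I -> set T'),
    (forall i, i \in J -> measurable (A i)) ->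
    P (\bigcap_(i in [set` J]) X i @^-1` A i) =
    (\prod_(i in J) P (X i @^-1` A i))%E.

Definition uniform_on d (T : measurableType d) (R : realType)
    (P : probability T R) (n : nat) (K : set 'rV[R]_n)
    (X : {RV P >-> 'rV[R]_n}) : Prop :=
  forall A, measurable A ->
    distribution P X A = (lebesgue_rV (A `&` K) / lebesgue_rV K)%E.

Definition iid_uniform_on d (T : measurableType d) (R : realType)
    (P : probability T R) (n : nat) (K : set 'rV[R]_n) (I : finType)
    (X : I -> {RV P >-> 'rV[R]_n}) : Prop :=
  mutually_independent X /\ forall i, uniform_on K (X i).

(* All the volumes below are finite when K is a convex body, so that fine     *)
(* loses no information.                                                      *)
Definition U_K d (T : measurableType d) (R : realType) (P : probability T R)
    (n : nat) (K : set 'rV[R]_n) (X : 'I_n.+1 -> {RV P >-> 'rV[R]_n}) :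
    T -> R := fun t =>
  fine (lebesgue_rV (conv_hull [set X i t | i in setT])) /
  fine (lebesgue_rV K).

Definition V_K d (T : measurableType d) (R : realType) (P : probability T R)
    (n : nat) (K : set 'rV[R]_n) (X : 'I_n -> {RV P >-> 'rV[R]_n}) :
    T -> R := fun t =>
  fine (lebesgue_rV (conv_hull
    ([set X i t | i in setT] `|` [set - X i t | i in setT]))) /
  fine (lebesgue_rV K).

(* Only the values of psi on [0, +oo[ matter; "increasing" is understood in   *)
(* the wide sense.                                                            *)
Definition orlicz_function (R : realType) (psi : R -> R) : Prop :=
  [/\ [/\ (forall t, 0 <= t -> 0 <= psi t),
          {within `[0, +oo[, continuous psi} &
          {in `[0, +oo[ &, {homo psi : s t / s <= t}}],
      convex_function (`[0, +oo[%classic : set (convex_lmodType R^o)) psi,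
      psi 0 = 0 & psi t @[t --> +oo] --> +oo].

(* Extended-real valued: the norm is +oo when no rho is admissible. *)
Definition orlicz_norm d (T : measurableType d) (R : realType)
    (P : probability T R) (psi : R -> R) (X : T -> R) : \bar R :=
  ereal_inf [set rho%:E | rho in
    [set rho : R | 0 < rho /\ ('E_P[fun t => psi (`|X t| / rho)%R] <= 1)%E]].

(* Main.v *)
Require Import Defs.
From HB Require Import structures.
From mathcomp Require Import all_boot all_order all_algebra fingroup perm.
From mathcomp Require Import all_classical all_reals all_analysis.
From mathcomp Require Import measurable_realfun.
From mathcomp Require Import ring lra.

Set Implicit Arguments.
Unset Strict Implicit.
Unset Printing Implicit Defensive.

Import Order.TTheory GRing.Theory Num.Theory.
Import numFieldNormedType.Exports.

Local Open Scope classical_set_scope.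
Local Open Scope ring_scope.

(** Write S for the corner simplex (nonnegative coordinates of sum at most 1)
    and put a = |S|/|K|. The hull of x_0, ..., x_n is an affine image of S and
    the hull of the points y_i and - y_i is the linear image of the
    cross-polytope, which has volume 2^n |S| ([lebesgue_crosspolytope]). Hence

      U = a |det(x_i - x_0)|    and    V = 2^n a |det(y_1, ..., y_n)|,

    and the proposition compares two random determinants.

    Let Delta(x_0, ..., x_n) = det(x_i - x_0). It is also the determinant of the
    matrix with rows (1, x_i), so it is affine in each x_i and expands along the
    column of ones.

    - Being affine in x_0, Delta averages over x_0 and - x_0 to its value at
      x_0 = 0, which is det(x_1, ..., x_n) ([det_rows_average]). Since K is
      symmetric, changing the sign of x_0 does not change the joint law.
      Therefore E psi(c |det(x_1, ..., x_n)|) <= E psi(c |Delta|) for every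
      convex increasing psi ([det_rows_moment_le]): this is the upper bound
      for V.
    - The expansion bounds |Delta| by the sum of n + 1 determinants of n of
      the points ([det_edges_le]), each distributed like det(y_1, ..., y_n).
      By convexity E psi(c |Delta| / (n + 1)) <= E psi(c |det(y)|)
      ([det_edges_moment_le]): this is the upper bound for U.

    Such a comparison of all convex moments bounds every Orlicz norm, every
    p-norm (psi(t) = t^p) and the essential supremum (psi(t) = max(0, t - y))
    at once ([orlicz_norm_le], [Lnorm_le]); taking n-th roots finishes.

    The volume formulas rest on the linear change of variables
    |C M| = |det M| |C| ([lebesgue_rV_mulmx]), proved for invertible M from an
    LUP factorization: permutations and diagonal matrices act on boxes, and
    unitriangular matrices are handled through the iterated integral that
    defines Lebesgue measure. *)

(** * Closed boxes generate the Borel sets of matrices *)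

Section boxes.
Context {R : realType}.

Definition mx_box m n (a b : 'M[R]_(m, n)) : set 'M[R]_(m, n) :=
  [set M | forall i j, a i j <= M i j <= b i j].

(** Indexed by a countable type, so that the union exhausting an open set below
    stays inside a sigma-algebra. *)
Definition rat_box m n (c : 'M[rat]_(m, n) * nat) : set 'M[R]_(m, n) :=
  let e := const_mx c.2.+1%:R^-1 in
  mx_box (map_mx ratr c.1 - e) (map_mx ratr c.1 + e).

Lemma open_mx_bigcup m n (O : set 'M[R]_(m, n)) : open O ->
  O = \bigcup_(c in [set c | rat_box c `<=` O]) rat_box c.
Proof.
move=> oO; apply/seteqP; split => [x Ox|x [c cO /cO]//].
have /nbhs_ballP[e /= e0 eO] := open_nbhs_nbhs (conj oO Ox).
have [k _ /(_ k (leqnn _)) ke] :=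
  near_infty_natSinv_lt (PosNum (divr_gt0 e0 (ltr0n _ 2))).
have k0 : 0 < k.+1%:R^-1 :> R by rewrite invr_gt0.
have /choice[q qx] (ij : 'I_m * 'I_n) : exists q : rat,
    `|ratr q - x ij.1 ij.2| < k.+1%:R^-1.
  have /rat_in_itvoo[q] :
      x ij.1 ij.2 - k.+1%:R^-1 < x ij.1 ij.2 + k.+1%:R^-1 :> R.
    by rewrite ltrD2l gtrN.
  by rewrite in_itv/= => qx; exists q; rewrite distrC ltr_distlC.
exists (\matrix_(i, j) q (i, j), k) => [y|i j] /=; last first.
  rewrite !mxE; have := qx (i, j); rewrite ltr_distlC /= => /andP[? ?].
  by rewrite !ltW.
move=> yq; apply: eO; split => // i j.
have {}ke : k.+1%:R^-1 < e / 2 := ke.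
have := yq i j; have := qx (i, j); rewrite !mxE/= ltr_distlC /ball/= ltr_distlC.
move: k.+1%:R^-1 ke => w ke /andP[? ?] /andP[? ?].
by apply/andP; split; lra.
Qed.

Lemma closed_mx_box m n (a b : 'M[R]_(m, n)) : closed (mx_box a b).
Proof.
rewrite (_ : mx_box a b = \bigcap_ij
    ((fun M : 'M[R]_(m, n) => M ij.1 ij.2) @^-1`
      (`[a ij.1 ij.2, b ij.1 ij.2]%classic : set R))).
  apply: closed_bigI => ij _; apply: preimage_closed => [v _|].
    exact: coord_continuous.
  exact: interval_closed.
apply/seteqP; split => v /= H.
  by move=> [i j] _; rewrite /= in_itv/=; exact: H.
by move=> i j; have := H (i, j) I; rewrite /= in_itv/=.
Qed.

Lemma measurable_mx_closed m n (A : set 'M[R]_(m, n)) :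
  closed A -> measurable A.
Proof.
move=> cA; rewrite -[A]setCK; apply: measurableC.
by apply: sub_sigma_algebra; exact: closed_openC.
Qed.

Lemma measurable_mx_box m n (a b : 'M[R]_(m, n)) : measurable (mx_box a b).
Proof. by apply: measurable_mx_closed; exact: closed_mx_box. Qed.

Definition mx_boxes m n : set (set 'M[R]_(m, n)) :=
  [set mx_box ab.1 ab.2 | ab in [set: 'M[R]_(m, n) * 'M[R]_(m, n)]].

(** Open sets are countable unions of rational boxes, and boxes are closed.
    Boxes being stable under intersection, measures can be compared on them. *)
Lemma mx_measurableE m n :
  @measurable _ 'M[R]_(m, n) = <<s @mx_boxes m n >>.
Proof.
apply/seteqP; split; apply: smallest_sub => //.
- move=> O /open_mx_bigcup ->.
  rewrite bigcup_mkcond.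
  apply: (@countable_bigcupT_measurable _ (g_sigma_algebraType (@mx_boxes m n))) => // c.
  case: ifPn => // _; apply: sub_sigma_algebra.
  pose e : 'M[R]_(m, n) := const_mx c.2.+1%:R^-1.
  by exists (map_mx ratr c.1 - e, map_mx ratr c.1 + e).
- exact: (@smallest_sigma_algebra _ setT (@open 'M[R]_(m, n))).
- by move=> _ [[a b]] _ <-; exact: measurable_mx_box.
Qed.

(** Measurability into matrices is entrywise, because a box is a finite
    intersection of conditions on single entries. *)
Lemma measurable_mx_fun d (T : measurableType d) m n (f : T -> 'M[R]_(m, n)) :
  (forall i j, measurable_fun setT (fun t => f t i j)) -> measurable_fun setT f.
Proof.
move=> mf; apply: (measurability (@mx_boxes m n)); first exact: mx_measurableE.
move=> _ [_ [[a b] _ <-] <-]; rewrite setTI.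
rewrite (_ : _ @^-1` _ = \bigcap_ij
    ((fun t => f t ij.1 ij.2) @^-1` `[a ij.1 ij.2, b ij.1 ij.2]%classic)).
  apply: fin_bigcap_measurable => // -[i j] _.
  by rewrite -[X in measurable X]setTI; apply: mf.
apply/seteqP; split => v /= H.
  by move=> [i j] _; rewrite /= in_itv/=; exact: H.
by move=> i j; have := H (i, j) I; rewrite /= in_itv/=.
Qed.

Lemma measurable_mx_coord m n i j :
  measurable_fun setT (fun M : 'M[R]_(m, n) => M i j).
Proof.
apply: (measurability (@RGenCInfty.G R)); first exact: RGenCInfty.measurableE.
move=> _ [_ [r ->] <-]; rewrite setTI; apply: measurable_mx_closed.
apply: preimage_closed => [v _|]; first exact: coord_continuous.
exact: interval_closed.
Qed.

(** Uniqueness of measures on a generating class stable under intersection,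
    with an exhaustion of the space by large boxes. *)
Lemma eq_measure_mx_box m n (m1 m2 : {measure set 'M[R]_(m, n) -> \bar R}) :
  (forall a b, m1 (mx_box a b) = m2 (mx_box a b)) ->
  (forall a b, (m1 (mx_box a b) < +oo)%E) ->
  forall A, measurable A -> m1 A = m2 A.
Proof.
move=> m12 m1oo; apply: (measure_unique (@mx_boxes m n)
  (fun k => mx_box (const_mx (- k%:R)) (const_mx k%:R))) => //.
- exact: mx_measurableE.
- move=> _ _ [[a b] _ <-] [[a' b'] _ <-].
  exists (\matrix_(i, j) Num.max (a i j) (a' i j),
          \matrix_(i, j) Num.min (b i j) (b' i j)) => //.
  apply/seteqP; split => [M/= H|M/= [H H'] i j]; last first.
    by have := H i j; have := H' i j; rewrite !mxE ge_max le_min => /andP[-> ->] /andP[-> ->].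
  by split => i j; have := H i j; rewrite !mxE ge_max le_min => /andP[/andP[? ?] /andP[? ?]]; apply/andP.
- by move=> k; exists (const_mx (- k%:R), const_mx k%:R).
- apply/seteqP; split => // v _.
  exists (Num.bound `|v|) => // i j; rewrite !mxE -ler_norml.
  apply: le_trans (ltW (archi_boundP (normr_ge0 v))).
  by rewrite [leRHS]mx_normrE; apply: le_trans (le_bigmax _ _ (i, j)).
- by move=> _ [[a b] _ <-].
Qed.

(** The maximum with 0 makes the product formula valid for empty boxes too, so
    that no side condition is needed when comparing measures on all boxes. *)
Lemma lebesgue_rV_mx_box n (a b : 'rV[R]_n) :
  lebesgue_rV (mx_box a b) = (\prod_i Num.max 0 (b 0 i - a 0 i))%:E.
Proof.
have [ab|/existsNP[i /negP]] := pselect (forall i, a 0 i <= b 0 i).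
  rewrite (_ : mx_box a b =
      [set v : 'rV[R]_n | forall i, a 0 i <= v 0 i <= b 0 i]); last first.
    by apply/seteqP; split => v /= H; [move=> j|move=> j k; rewrite ord1]; exact: H.
  rewrite lebesgue_rV_box//; congr _%:E; apply: eq_bigr => i _.
  by rewrite max_r ?subr_ge0.
rewrite -ltNge => ba; rewrite (bigD1 i)//= max_l ?subr_le0 ?ltW// mul0r.
rewrite (_ : mx_box a b = set0) ?measure0//.
apply/seteqP; split => // v /(_ 0 i) /andP[av vb].
by have := le_lt_trans (le_trans av vb) ba; rewrite ltxx.
Qed.

End boxes.

(** * Linear change of variables for Lebesgue measure *)

Section linear_images.
Context {R : realType}.

(** Both sides are measures in A, so they need only be compared on boxes. *)
Lemma lebesgue_rV_preimage n (f : 'rV[R]_n -> 'rV[R]_n) (c : R) :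
  measurable_fun setT f -> 0 <= c ->
  (forall a b, lebesgue_rV (f @^-1` mx_box a b) =
    (c%:E * lebesgue_rV (mx_box a b))%E) ->
  forall A, measurable A -> lebesgue_rV (f @^-1` A) = (c%:E * lebesgue_rV A)%E.
Proof.
move=> mf c0 fbox A mA; apply/esym.
pose F : {mfun 'rV[R]_n >-> 'rV[R]_n} :=
  HB.pack f (@isMeasurableFun.Build _ _ _ _ _ mf).
apply: (@eq_measure_mx_box R 1 n (mscale (NngNum c0) (@lebesgue_rV R n))
  (pushforward (@lebesgue_rV R n) F)) => // a b.
  exact: esym (fbox a b).
change (c%:E * lebesgue_rV (mx_box a b) < +oo)%E.
by rewrite lebesgue_rV_mx_box -EFinM ltry.
Qed.

Lemma measurable_mulmxr n (M : 'M[R]_n) :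
  measurable_fun setT (fun v : 'rV[R]_n => v *m M).
Proof.
apply: measurable_mx_fun => i j.
under eq_fun do rewrite mxE.
apply: measurable_sum => k; apply: measurable_funM => //.
exact: measurable_mx_coord.
Qed.

Lemma measurable_addmxr n (c : 'rV[R]_n) :
  measurable_fun setT (fun v : 'rV[R]_n => v + c).
Proof.
apply: measurable_mx_fun => i j.
under eq_fun do rewrite mxE.
apply: measurable_funD => //.
exact: measurable_mx_coord.
Qed.

Lemma measurable_preimageT d d' (T : measurableType d) (T' : measurableType d')
  (f : T -> T') A : measurable_fun setT f -> measurable A -> measurable (f @^-1` A).
Proof. by move=> mf mA; rewrite -[X in measurable X]setTI; exact: mf. Qed.

Lemma lebesgue_rV_shift n (c : 'rV[R]_n) A : measurable A ->
  lebesgue_rV [set v | A (v + c)] = lebesgue_rV A.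
Proof.
move=> mA; rewrite -[RHS]mul1e.
apply: (@lebesgue_rV_preimage _ (fun v => v + c)) => //.
  exact: measurable_addmxr.
move=> a b; rewrite mul1e.
rewrite (_ : _ @^-1` _ = mx_box (a - c) (b - c)); last first.
  by apply/seteqP; split => v H i j; have := H i j; rewrite !mxE lerBlDr lerBrDr.
rewrite !lebesgue_rV_mx_box; congr (_%:E); apply: eq_bigr => i _.
by rewrite !mxE; congr Num.max; ring.
Qed.

(** The change of variables formula for a matrix M, for preimages: the form that
    makes sense for every Borel set and is stable under products. *)
Definition scales n (M : 'M[R]_n) := forall A, measurable A ->
  lebesgue_rV [set v | A (v *m M)] = (`|\det M|^-1%:E * lebesgue_rV A)%E.

Lemma scalesM n (M N : 'M[R]_n) : scales M -> scales N -> scales (M *m N).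
Proof.
move=> sM sN A mA.
under eq_set do rewrite mulmxA.
rewrite (sM [set v | A (v *m N)]); last first.
  exact: (measurable_preimageT (@measurable_mulmxr _ N)).
by rewrite sN// muleA -EFinM det_mulmx normrM invfM.
Qed.

(** A diagonal matrix pulls a box back to a box; a negative entry exchanges the
    two ends of the corresponding side. *)
Lemma scales_diag n (D : 'rV[R]_n) : (forall i, D 0 i != 0) -> scales (diag_mx D).
Proof.
move=> D0 A mA.
apply: (@lebesgue_rV_preimage _ (fun v => v *m diag_mx D)) => //.
  exact: measurable_mulmxr.
move=> a b.
rewrite (_ : _ @^-1` _ = mx_box
    (\row_i (if 0 < D 0 i then a 0 i / D 0 i else b 0 i / D 0 i))
    (\row_i (if 0 < D 0 i then b 0 i / D 0 i else a 0 i / D 0 i))); last first.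
  apply/seteqP; split => v H i j; have := H i j; rewrite mul_mx_diag !mxE ord1;
    have := D0 j; rewrite neq_lt => /orP[d|d].
  - rewrite ltNge (ltW d) /= ler_ndivrMr// ler_ndivlMr// andbC//.
  - rewrite d ler_pdivrMr// ler_pdivlMr//.
  - rewrite ltNge (ltW d) /= ler_ndivrMr// ler_ndivlMr// andbC//.
  - rewrite d ler_pdivrMr// ler_pdivlMr//.
rewrite !lebesgue_rV_mx_box -EFinM det_diag normr_prod -prodfV -big_split/=.
congr (_%:E); apply: eq_bigr => i _.
rewrite maxr_pMr ?invr_ge0// mulr0 !mxE; congr Num.max.
have := D0 i; rewrite neq_lt => /orP[d|d].
  by rewrite ltNge (ltW d)/= ltr0_norm//; field; exact: D0.
by rewrite d gtr0_norm//; field; exact: D0.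
Qed.

Lemma scales_perm n (s : 'S_n) : scales (perm_mx s).
Proof.
move=> A mA.
apply: (@lebesgue_rV_preimage _ (fun v => v *m perm_mx s)) => //.
  exact: measurable_mulmxr.
have pE (v : 'rV[R]_n) i j : (v *m perm_mx s) i j = v i ((s^-1)%g j).
  by rewrite -[s in perm_mx s]invgK -col_permE mxE.
move=> a b.
rewrite (_ : _ @^-1` _ = mx_box (\row_i a 0 (s i)) (\row_i b 0 (s i))); last first.
  apply/seteqP; split => v H i j.
    by have := H i (s j); rewrite ord1 pE permK !mxE.
  by have := H i ((s^-1)%g j); rewrite ord1 pE !mxE permKV.
rewrite !lebesgue_rV_mx_box -EFinM det_perm normrX normrN1 expr1n invr1 mul1r.
congr (_%:E); rewrite [RHS](reindex_inj (@perm_inj _ s)).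
by apply: eq_bigr => i _; rewrite !mxE.
Qed.

Lemma measurable_row_mx n (x : R) :
  measurable_fun setT (fun v : 'rV[R]_n => row_mx (x%:M : 'rV_1) v).
Proof.
apply: measurable_mx_fun => i j.
under eq_fun do rewrite mxE.
by case: fintype.split => k; [exact: measurable_cst|exact: measurable_mx_coord].
Qed.

(** Induction on the dimension: over a fixed first coordinate x, the matrix acts
    on the section by a smaller unitriangular matrix followed by a translation
    depending on x, neither of which changes the volume of the section. *)
Lemma scales_unitri n (N : 'M[R]_n) :
  (forall i j : 'I_n, (j <= i)%N -> N i j = (i == j)%:R) -> scales N.
Proof.
move=> NE; have dN : \det N = 1.
  rewrite -det_tr det_trig; last first.
    apply/is_trig_mxP => i j ij; rewrite mxE NE//; last exact: ltnW.
    by rewrite gt_eqF.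
  by rewrite big1// => i _; rewrite mxE NE// eqxx.
move=> A mA; rewrite dN normr1 invr1 mul1e {dN}.
elim: n => [|n IH] in N NE A mA *.
  by congr lebesgue_rV; apply/seteqP; split => v /=; rewrite [_ *m _]thinmx0 [v]thinmx0.
rewrite !lebesgue_rVS; apply: eq_integral => x _.
pose M : 'M[R]_(1 + n) := N.
pose b := x%:M *m ursubmx M.
pose Ax := [set v : 'rV[R]_n | A (row_mx (x%:M : 'rV_1) v)].
have mAx : measurable Ax := measurable_preimageT (@measurable_row_mx n x) mA.
rewrite -[RHS]/(lebesgue_rV Ax) -[RHS](lebesgue_rV_shift b mAx).
rewrite -[RHS](IH (drsubmx M)); last 2 first.
- move=> i j ij; rewrite !mxE NE ?leq_add2l//.
- exact: (measurable_preimageT (@measurable_addmxr _ b)).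
have M1 : ulsubmx M = 1%:M.
  by apply/matrixP => i j; rewrite !mxE !ord1 NE.
have M0 : dlsubmx M = 0.
  apply/matrixP => i j; rewrite !mxE !ord1 NE//=.
congr lebesgue_rV; rewrite /Ax; apply/funext => v /=; congr A.
transitivity (row_mx (x%:M : 'M[R]_1) v *m M) => //.
by rewrite -[in LHS](submxK M) M1 M0 mul_row_block mulmx0 addr0 mulmx1 addrC.
Qed.

(** Reversing the order of the coordinates on both sides turns a lower
    unitriangular matrix into an upper one. *)
Lemma scales_unitri_lower n (N : 'M[R]_n) :
  (forall i j : 'I_n, (i <= j)%N -> N i j = (i == j)%:R) -> scales N.
Proof.
move=> NE; pose s : 'S_n := perm (@rev_ord_inj n).
have sK : (s * s = 1)%g by apply/permP => i; rewrite permM !permE rev_ordK.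
have sE : (s^-1)%g = s by apply/eqP; rewrite eq_invg_mul sK.
rewrite (_ : N = perm_mx s *m (perm_mx s *m N *m perm_mx s) *m perm_mx s).
  apply: scalesM; last exact: scales_perm.
  apply: scalesM; first exact: scales_perm.
  apply: scales_unitri => i j ij.
  rewrite -[X in _ *m perm_mx X]sE -row_permE -col_permE !mxE !permE NE.
    by rewrite (inj_eq rev_ord_inj).
  by rewrite /= leq_sub2l.
by rewrite !mulmxA -perm_mxM sK perm_mx1 mul1mx -mulmxA -perm_mxM sK perm_mx1 mulmx1.
Qed.

(** By the LUP factorization, with the upper factor written as a diagonal matrix
    times a unitriangular one. *)
Lemma scales_unit n (M : 'M[R]_n) : M \in unitmx -> scales M.
Proof.
case: n M => [M _|n M uM].
  by rewrite [M]thinmx0; apply: scales_unitri => -[].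
have := cormen_lup_correct M; have := cormen_lup_perm M.
have := cormen_lup_lower M; have := @cormen_lup_upper _ _ M.
have := cormen_lup_detL M.
case: cormen_lup => -[P L] U /= dL uU lL /is_perm_mxP[s ->{P}] PM.
have dU : \prod_i U i i != 0.
  have <- : \det U = \prod_i U i i.
    rewrite -det_tr det_trig; last first.
      by apply/is_trig_mxP => i j ij; rewrite mxE uU.
    by apply: eq_bigr => i _; rewrite mxE.
  apply/eqP => dU; have := congr1 determinant PM.
  rewrite !det_mulmx dU mulr0 => /eqP; rewrite mulf_eq0 det_perm signr_eq0/=.
  by move: uM; rewrite unitmxE unitfE => /negbTE ->.
have U0 i : U i i != 0 by move/prodf_neq0 : dU; exact.
have -> : M = perm_mx s^-1 *m L *m (diag_mx (\row_i U i i) *m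
    (\matrix_(i, j) (U i j / U i i))).
  rewrite -mulmxA (_ : diag_mx _ *m _ = U).
    rewrite -[L *m U]PM. by rewrite mulmxA -perm_mxM mulVg perm_mx1 mul1mx.
  apply/matrixP => i j; rewrite mul_diag_mx !mxE.
  by field; exact: U0.
apply: scalesM; first apply: scalesM; last apply: scalesM.
- exact: scales_perm.
- exact: scales_unitri_lower.
- by apply: scales_diag => i; rewrite mxE.
- apply: scales_unitri => i j; rewrite leq_eqVlt => /predU1P[/val_inj ->|ij].
    by rewrite mxE divff// eqxx.
  by rewrite mxE uU// mul0r gt_eqF.
Qed.

End linear_images.

(** * The cross-polytope has the volume of 2^n corner simplices *)

Section crosspolytope_volume.
Context {R : realType}.

Definition crosspolytope n (s : R) : set 'rV[R]_n :=
  [set v | \sum_i `|v 0 i| <= s].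

(** For s >= 0, the convex hull of 0 and s times the standard basis vectors. *)
Definition corner_simplex n (s : R) : set 'rV[R]_n :=
  [set v | (forall i, 0 <= v 0 i) /\ \sum_i v 0 i <= s].

Arguments crosspolytope n s : clear implicits.
Arguments corner_simplex n s : clear implicits.

Lemma corner_simplexE n s : corner_simplex n s =
  (\bigcap_i [set v : 'rV[R]_n | 0 <= v 0 i]) `&` crosspolytope n s.
Proof.
have normE (v : 'rV[R]_n) : (forall i, 0 <= v 0 i) ->
    \sum_i `|v 0 i| = \sum_i v 0 i.
  by move=> v0; apply: eq_bigr => i _; rewrite ger0_norm.
apply/seteqP; split=> v /= [v0 vs].
  by split; [move=> i _; exact: v0|rewrite /crosspolytope/= normE].
have {}v0 i : 0 <= v 0 i by exact: v0.
by split => //; rewrite -normE.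
Qed.

Lemma closed_crosspolytope n s : closed (crosspolytope n s).
Proof.
rewrite (_ : crosspolytope _ _ =
  (fun v : 'rV[R]_n => \sum_i `|v 0 i|) @^-1` [set x : R | x <= s]) //.
apply: preimage_closed => [v _|]; last exact: closed_le.
apply: continuous_big => [|i _ w]; first exact: add_continuous.
by apply: continuous_comp; [exact: coord_continuous|exact: norm_continuous].
Qed.

Lemma closed_corner_simplex n s : closed (corner_simplex n s).
Proof.
rewrite corner_simplexE; apply: closedI; last exact: closed_crosspolytope.
apply: closed_bigI => i _.
rewrite (_ : mkset _ = (fun v : 'rV[R]_n => v 0 i) @^-1` [set x : R | 0 <= x]) //.
by apply: preimage_closed => [v _|]; [exact: coord_continuous|exact: closed_ge].
Qed.

Lemma crosspolytope_box n s : crosspolytope n s `<=` mx_box (const_mx (- s)) (const_mx s).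
Proof.
move=> v /= vs i j; rewrite ord1 !mxE -ler_norml; apply: le_trans vs.
by rewrite (bigD1 j)//= lerDl sumr_ge0.
Qed.

Lemma corner_simplex_crosspolytope n s :
  corner_simplex n s `<=` crosspolytope n s.
Proof. by rewrite corner_simplexE => v []. Qed.

Lemma compact_mx_box n (a b : 'rV[R]_n) : compact (mx_box a b).
Proof.
rewrite (_ : mx_box a b =
    [set v : 'rV[R]_n | forall i, `[a 0 i, b 0 i]%classic (v ord0 i)]).
  by apply: (@rV_compact _ _ (fun i => `[a 0 i, b 0 i]%classic)) => i; exact: segment_compact.
by apply/seteqP; split => v /= H i; [|move=> j]; rewrite ?ord1 /= ?in_itv/=;
  [exact: H|have := H j; rewrite in_itv].
Qed.

Lemma compact_crosspolytope n s : compact (crosspolytope n s).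
Proof.
apply: subclosed_compact (@crosspolytope_box n s).
- exact: closed_crosspolytope.
- exact: compact_mx_box.
Qed.

Lemma compact_corner_simplex n s : compact (corner_simplex n s).
Proof.
apply: subclosed_compact (@corner_simplex_crosspolytope n s).
- exact: closed_corner_simplex.
- exact: compact_crosspolytope.
Qed.

Lemma lebesgue_corner_simplex_lty n s : (lebesgue_rV (corner_simplex n s) < +oo)%E.
Proof.
apply: (@le_lt_trans _ _ (lebesgue_rV (mx_box (const_mx (- s) : 'rV[R]_n) (const_mx s)))).
  apply: le_measure; rewrite ?inE.
  - by apply: measurable_mx_closed; exact: closed_corner_simplex.
  - exact: measurable_mx_box.
  - exact: subset_trans (@corner_simplex_crosspolytope n s) (@crosspolytope_box n s).
by rewrite lebesgue_rV_mx_box ltry.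
Qed.

Local Open Scope ereal_scope.

(** Stated for measurable functions because it is applied to the volume of a
    slice, which is known to be monotone in |x| but not to be continuous. *)
Lemma ge0_even_integralT (g : R -> \bar R) : measurable_fun setT g ->
  (forall x, 0 <= g x) -> (forall x, g (- x)%R = g x) ->
  \int[lebesgue_measure]_x g x =
  2%:E * \int[lebesgue_measure]_(x in `[0%R, +oo[) g x.
Proof.
move=> mg g0 gN.
have mgS (A : set R) : measurable_fun A g by exact: measurable_funS mg.
rewrite -(set_itvNyy R) (@itv_bndbnd_setU _ _ _ (BLeft 0%R))//.
rewrite ge0_integral_setU//=; first last.
  apply/disj_set2P; rewrite -subset0 => x /=.
    by rewrite !in_itv/= andbT => -[/lt_le_trans xx /xx]; rewrite ltxx.
  exact: mgS.
rewrite mule_natl mule2n; congr (_ + _).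
rewrite integral_itv_bndo_bndc// ge0_integration_by_substitution0//.
by apply: eq_integral => x _; rewrite gN.
Qed.

(** Induction on the dimension, by slicing along the first coordinate: the slice
    at x is the same polytope of size s - |x|, for all x in the case of the
    cross-polytope but only for x >= 0 in the case of the simplex. Each
    dimension thus contributes a factor 2. *)
Lemma lebesgue_crosspolytope n s :
  lebesgue_rV (crosspolytope n s) = (2 ^+ n)%:E * lebesgue_rV (corner_simplex n s).
Proof.
elim: n s => [|n IH] s.
  rewrite expr0 mul1e; congr lebesgue_rV; apply/seteqP.
  split=> v; rewrite /crosspolytope /corner_simplex/= !big_ord0; last by case.
  by split=> // -[].
pose G (t : R) := fine (lebesgue_rV (corner_simplex n t)).
have GE t : (G t)%:E = lebesgue_rV (corner_simplex n t).
  by rewrite fineK// ge0_fin_numE// lebesgue_corner_simplex_lty.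
have mG : measurable_fun setT G.
  apply: nondecreasing_measurable => // t u tu.
  rewrite -lee_fin !GE; apply: le_measure; rewrite ?inE.
  - by apply: measurable_mx_closed; exact: closed_corner_simplex.
  - by apply: measurable_mx_closed; exact: closed_corner_simplex.
  - by move=> v /= [v0 vt]; split => //; exact: le_trans tu.
pose g (x : R) := (G (s - `|x|)%R)%:E.
have mg : measurable_fun setT g.
  apply/measurable_EFinP; apply: (measurableT_comp mG).
  by apply: measurable_funB => //; exact: measurable_normr.
have sumE (F : R -> R) (x : R) (v : 'rV[R]_n) :
    (\sum_i F (row_mx (x%:M : 'rV[R]_1) v 0 i) = F x + \sum_i F (v 0 i))%R.
  transitivity (\sum_(i < 1 + n) F (row_mx (x%:M : 'M[R]_1) v 0 i))%R => //.
  rewrite big_split_ord/= big_ord1 row_mxEl mxE eqxx mulr1n; congr (_ + _)%R.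
  by apply: eq_bigr => i _; rewrite row_mxEr.
have -> : lebesgue_rV (crosspolytope n.+1 s) =
    \int[lebesgue_measure]_x ((2 ^+ n)%:E * g x).
  rewrite lebesgue_rVS; apply: eq_integral => x _.
  rewrite /g GE -IH; congr lebesgue_rV.
  apply/seteqP; split => v; rewrite /crosspolytope/= (sumE Num.norm x) -lerBrDl//.
have -> : lebesgue_rV (corner_simplex n.+1 s) =
    \int[lebesgue_measure]_(x in `[0%R, +oo[) g x.
  rewrite lebesgue_rVS [in RHS]integral_mkcond; apply: eq_integral => x _.
  rewrite patchE; case: ifPn.
    rewrite inE/= in_itv/= andbT => x0; rewrite /g GE; congr lebesgue_rV.
    apply/seteqP; split => v; rewrite /corner_simplex/= (sumE id) -lerBrDl ger0_norm// => -[v0 vs].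
      by split => // i; have := v0 (@rshift 1 n i); rewrite (@row_mxEr R 1 1 n).
    split => // i; case: (@split_ordP 1 n i) => j ->.
      by rewrite (@row_mxEl R 1 1 n) mxE !ord1 eqxx mulr1n.
    by rewrite (@row_mxEr R 1 1 n).
  rewrite notin_setE/= in_itv/= andbT => x0.
  rewrite (_ : [set _ | _] = set0) ?measure0//.
  apply/seteqP; split => // v [/(_ (@lshift 1 n ord0)) + _].
  by rewrite (@row_mxEl R 1 1 n) mxE eqxx mulr1n.
rewrite ge0_integralZl//; last by move=> x _; rewrite /g GE.
rewrite ge0_even_integralT//; last 2 first.
- by move=> x; rewrite /g GE.
- by move=> x; rewrite /g normrN.
by rewrite exprSr EFinM muleA.
Qed.

End crosspolytope_volume.

Arguments crosspolytope {R} n s.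
Arguments corner_simplex {R} n s.

(** * Volumes of the random convex hulls as determinants *)

Section hulls.
Context {R : realType}.

Lemma continuous_mx (T : topologicalType) m n (f : T -> 'M[R]_(m, n)) :
  (forall i j, continuous (fun t => f t i j)) -> continuous f.
Proof.
move=> cf x; apply/cvg_ballP => e e0.
have : \forall y \near x, forall ij : 'I_m * 'I_n,
    ball (f x ij.1 ij.2) e (f y ij.1 ij.2).
  by apply: filter_forall => ij; exact: (cvg_ball (@cf _ _ x) e0).
by apply: filterS => y H; split => // i j; exact: (H (i, j)).
Qed.

Lemma continuous_mulmxr n (M : 'M[R]_n) : continuous (fun v : 'rV[R]_n => v *m M).
Proof.
apply: continuous_mx => i j.
under eq_fun do rewrite mxE.
apply: continuous_big => [|k _ w]; first exact: add_continuous.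
apply: (@continuousM R 'rV[R]_n (fun v => v i k) (cst (M k j)) w).
  exact: (@coord_continuous R 1 n i k w).
exact: cst_continuous.
Qed.

Lemma measurable_mx_compact n (C : set 'rV[R]_n) : compact C -> measurable C.
Proof.
by move=> cC; apply: measurable_mx_closed; apply: compact_closed cC; exact: norm_hausdorff.
Qed.

Lemma compact_mulmx_image n (M : 'M[R]_n) (C : set 'rV[R]_n) :
  compact C -> compact [set v *m M | v in C].
Proof.
move=> cC; apply: (@continuous_compact 'rV[R]_n 'rV[R]_n (fun v => v *m M) C) => //.
by apply: continuous_subspaceT; exact: continuous_mulmxr.
Qed.

(** A compact part of a coordinate hyperplane lies in a box with one side of
    length 0. *)
Lemma lebesgue_rV_hyperplane n (C : set 'rV[R]_n) (j : 'I_n) : compact C ->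
  (forall v, C v -> v 0 j = 0) -> lebesgue_rV C = 0%E.
Proof.
move=> cC C0; have [k [_ kC]] := compact_bounded cC.
pose a : 'rV[R]_n := \row_i (if i == j then 0 else - (k + 1)).
pose b : 'rV[R]_n := \row_i (if i == j then 0 else k + 1).
apply/eqP; rewrite eq_le lebesgue_rV_ge0 andbT.
apply: (@le_trans _ _ (lebesgue_rV (mx_box a b))).
  apply: le_measure; rewrite ?inE.
  - exact: measurable_mx_compact.
  - exact: measurable_mx_box.
  move=> v Cv i0 i; rewrite ord1 !mxE; case: eqP => [->|_]; first by rewrite C0// lexx.
  rewrite -ler_norml; apply: le_trans (kC (k + 1) _ v Cv); last by rewrite ltrDl.
  by rewrite [leRHS]mx_normrE; apply: le_trans (le_bigmax _ _ (0, i)).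
by rewrite lebesgue_rV_mx_box (bigD1 j)//= !mxE eqxx subrr maxxx mul0r.
Qed.

(** If M is singular, it factors through a matrix whose last column is zero,
    followed by an invertible one: the image is the invertible image of a subset
    of a coordinate hyperplane. *)
Lemma lebesgue_rV_mulmx n (M : 'M[R]_n) (C : set 'rV[R]_n) : compact C ->
  lebesgue_rV [set v *m M | v in C] = (`|\det M|%:E * lebesgue_rV C)%E.
Proof.
have unit_case (N : 'M[R]_n) (D : set 'rV[R]_n) : N \in unitmx -> compact D ->
    lebesgue_rV [set v *m N | v in D] = (`|\det N|%:E * lebesgue_rV D)%E.
  move=> uN cD; rewrite (_ : [set _ | _ in _] = [set v | D (v *m invmx N)]).
    rewrite scales_unit ?unitmx_inv//; last exact: measurable_mx_compact.
    by rewrite det_inv normfV invrK.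
  apply/seteqP; split => [_ [v Dv <-]|v Dv]/=; first by rewrite mulmxK.
  by exists (v *m invmx N) => //; rewrite mulmxKV.
move=> cC; have [uM|nuM] := boolP (M \in unitmx); first exact: unit_case.
have dM : \det M = 0 by apply/eqP; move: nuM; rewrite unitmxE unitfE negbK.
rewrite dM normr0 mul0e.
have rM : (\rank M < n)%N.
  by rewrite ltn_neqAle rank_leq_row andbT -/(row_free M) row_free_unit.
case: n => [|n] in M C cC unit_case dM nuM rM *; first by [].
pose N : 'M[R]_n.+1 := col_ebase M *m pid_mx (\rank M).
have E : M = N *m row_ebase M by rewrite mulmx_ebase.
have -> : [set v *m M | v in C] =
    [set w *m row_ebase M | w in [set v *m N | v in C]].
  by rewrite image_comp; congr (_ @` _); apply/funext => v /=; rewrite -mulmxA -E.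
have cN := @compact_mulmx_image _ N C cC.
rewrite unit_case//; last exact: row_ebase_unit.
rewrite (@lebesgue_rV_hyperplane _ _ ord_max) ?mule0// => _ [v _ <-].
rewrite /N mulmxA mxE big1// => i _; rewrite [pid_mx _ _ _]mxE.
case: eqP => [i_max|]; last by rewrite mulr0.
by rewrite i_max ltnNge -ltnS rM mulr0.
Qed.

Lemma conv_hull_sub n (A B : set 'rV[R]_n) :
  convex_set (B : set (convex_lmodType 'rV[R]_n)) -> A `<=` B -> conv_hull A `<=` B.
Proof. by move=> cB AB; exact: smallest_sub. Qed.

Lemma convex_set_sum (E : lmodType R) (B : set (convex_lmodType E)) k
    (w : 'I_k -> R) (x : 'I_k -> E) :
  convex_set B -> (forall i, 0 <= w i) -> \sum_i w i = 1 ->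
  (forall i, B (x i)) -> B (\sum_i w i *: x i).
Proof.
move=> cB; elim: k w x => [|k IH] w x w0 w1 Bx.
  by move: w1; rewrite big_ord0 => /eqP; rewrite eq_sym oner_eq0.
rewrite big_ord_recl; move: w1; rewrite big_ord_recl => w1.
set s := \sum_(i < k) _ in w1.
have s0 : 0 <= s by apply: sumr_ge0.
have [s_eq0|s_neq0] := eqVneq s 0.
  rewrite big1 ?addr0.
    by move: w1; rewrite s_eq0 addr0 => ->; rewrite scale1r.
  move=> i _; suff -> : w (lift ord0 i) = 0 by rewrite scale0r.
  by move/eqP: s_eq0; rewrite psumr_eq0// => /allP/(_ i); rewrite mem_index_enum => /(_ isT)/eqP.
have w01 : w ord0 <= 1 by rewrite -w1 lerDl.
have By : B (\sum_(i < k) (w (lift ord0 i) / s) *: x (lift ord0 i)).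
  by apply: IH => // [i|]; [exact: divr_ge0|rewrite -mulr_suml divff].
rewrite (_ : \sum_(i < k) _ =
    (1 - w ord0) *: \sum_(i < k) (w (lift ord0 i) / s) *: x (lift ord0 i)).
  have := cB (x ord0) _ (Itv01 (w0 ord0) w01) (mem_set (Bx ord0)) (mem_set By).
  by rewrite inE.
rewrite (_ : 1 - w ord0 = s); last by rewrite -w1 addrAC subrr add0r.
rewrite scaler_sumr; apply: eq_bigr => i _.
by rewrite scalerA mulrCA divff// mulr1.
Qed.

Lemma convex_crosspolytope n s :
  convex_set (crosspolytope n s : set (convex_lmodType 'rV[R]_n)).
Proof.
move=> x y t; rewrite !inE /crosspolytope/= => xs ys.
have t0 : 0 <= t%:num by []. have t1 : 0 <= 1 - t%:num by rewrite subr_ge0.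
apply: (@le_trans _ _ (t%:num * (\sum_i `|x 0 i|) + (1 - t%:num) * (\sum_i `|y 0 i|))).
  rewrite !mulr_sumr -big_split/=; apply: ler_sum => i _.
  rewrite !mxE; apply: le_trans (ler_normD _ _) _.
  by rewrite !normrM (ger0_norm t0) (ger0_norm t1).
rewrite -[leRHS](_ : t%:num * s + (1 - t%:num) * s = _); last by ring.
by apply: lerD; apply: ler_wpM2l.
Qed.

Lemma convex_corner_simplex n s :
  convex_set (corner_simplex n s : set (convex_lmodType 'rV[R]_n)).
Proof.
move=> x y t; rewrite !inE => -[x0 xs] [y0 ys].
have t0 : 0 <= t%:num by []. have t1 : 0 <= 1 - t%:num by rewrite subr_ge0.
split => [i|]; first by rewrite !mxE addr_ge0// mulr_ge0.
apply: (@le_trans _ _ (t%:num * (\sum_i x 0 i) + (1 - t%:num) * (\sum_i y 0 i))).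
  by rewrite !mulr_sumr -big_split/=; apply: ler_sum => i _; rewrite !mxE.
rewrite -[leRHS](_ : t%:num * s + (1 - t%:num) * s = _); last by ring.
by apply: lerD; apply: ler_wpM2l.
Qed.

Lemma convex_affine_image n (M : 'M[R]_n) (c : 'rV[R]_n) (C : set 'rV[R]_n) :
  convex_set (C : set (convex_lmodType 'rV[R]_n)) ->
  convex_set ([set v *m M + c | v in C] : set (convex_lmodType 'rV[R]_n)).
Proof.
move=> cC p q t; rewrite !inE => -[x Cx <-] [y Cy <-].
exists (conv t (x : convex_lmodType 'rV[R]_n) y).
  by have := cC x y t; rewrite !inE; apply.
rewrite /conv/= mulmxDl -!scalemxAl !scalerDr addrACA -scalerDl.
by rewrite subrKC scale1r.
Qed.

(** The weight of x_0 in a convex combination is what the other n weights leave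
    of 1, so that the other n weights range over the corner simplex. *)
Lemma conv_hull_simplex n (x : 'I_n.+1 -> 'rV[R]_n) :
  conv_hull [set x i | i in setT] =
  [set v *m (\matrix_i (x (lift ord0 i) - x ord0)) + x ord0 | v in corner_simplex n 1].
Proof.
set M := \matrix_i _.
have vM (v : 'rV[R]_n) : v *m M = \sum_i v 0 i *: (x (lift ord0 i) - x ord0).
  by rewrite mulmx_sum_row; apply: eq_bigr => i _; rewrite rowK.
apply/seteqP; split.
  apply: conv_hull_sub; first exact/convex_affine_image/convex_corner_simplex.
  move=> _ [i _ <-]; case: (unliftP ord0 i) => [j ->|->].
    exists (delta_mx 0 j); last by rewrite -rowE rowK subrK.
    split => [k|]; first by rewrite mxE; case: (_ && _).
    rewrite (bigD1 j)//= mxE !eqxx big1 ?addr0// => k kj.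
    by rewrite mxE (negbTE kj) andbF.
  exists 0; last by rewrite mul0mx add0r.
  by split => [k|]; [rewrite mxE|rewrite big1// => k _; rewrite mxE].
move=> _ [v [v0 v1] <-] B [cB AB].
pose w i := if unlift ord0 i is Some j then v 0 j else 1 - \sum_i v 0 i.
have w_ord0 : w ord0 = 1 - \sum_i v 0 i by rewrite /w unlift_none.
have w_lift j : w (lift ord0 j) = v 0 j by rewrite /w liftK.
have -> : v *m M + x ord0 = \sum_i w i *: x i.
  rewrite vM big_ord_recl w_ord0 scalerBl scale1r scaler_suml.
  under eq_bigr do rewrite scalerBr.
  rewrite sumrB addrC addrA addrAC; congr (_ + _).
  by apply: eq_bigr => i _; rewrite w_lift.
apply: convex_set_sum => //.
- by move=> i; rewrite /w; case: unlift => [j|]; [exact: v0|rewrite subr_ge0].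
- rewrite big_ord_recl w_ord0.
  by under [X in _ + X]eq_bigr do rewrite w_lift; rewrite subrK.
- by move=> i; apply: AB; exists i.
Qed.

(** A point of coordinates v in the cross-polytope is the combination of the
    y_i and - y_i with weights (|v_i| + v_i)/2 + e and (|v_i| - v_i)/2 + e, where
    e spreads the defect 1 - sum |v_i| evenly over the 2n weights. *)
Lemma conv_hull_crosspolytope n (y : 'I_n -> 'rV[R]_n) : (0 < n)%N ->
  conv_hull ([set y i | i in setT] `|` [set - y i | i in setT]) =
  [set v *m (\matrix_i y i) | v in crosspolytope n 1].
Proof.
move=> n0; set M := \matrix_i _; set A := _ `|` _.
apply/seteqP; split.
  have -> : [set v *m M | v in crosspolytope n 1] =
      [set v *m M + 0 | v in crosspolytope n 1].
    by congr image; apply/funext => v; rewrite addr0.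
  apply: conv_hull_sub; first exact/convex_affine_image/convex_crosspolytope.
  have sum_delta (j : 'I_n) : \sum_i `|(delta_mx 0 j : 'rV[R]_n) 0 i| = 1.
    rewrite (bigD1 j)//= mxE !eqxx normr1 big1 ?addr0// => k kj.
    by rewrite mxE (negbTE kj) andbF normr0.
  move=> _ [[i _ <-]|[i _ <-]].
    by exists (delta_mx 0 i); [rewrite /crosspolytope/= sum_delta|rewrite -rowE rowK addr0].
  exists (- delta_mx 0 i); last by rewrite mulNmx -rowE rowK addr0.
  rewrite /crosspolytope/=; under eq_bigr do rewrite mxE normrN.
  by rewrite sum_delta.
move=> _ [v v1 <-] B [cB AB].
pose e := (1 - \sum_i `|v 0 i|) / (2 * n%:R).
have e0 : 0 <= e by rewrite divr_ge0// subr_ge0.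
pose w (k : 'I_(n + n)) := match fintype.split k with
  | inl i => (`|v 0 i| + v 0 i) / 2 + e | inr i => (`|v 0 i| - v 0 i) / 2 + e end.
pose x (k : 'I_(n + n)) := match fintype.split k with
  | inl i => y i | inr i => - y i end.
have -> : v *m M = \sum_k w k *: x k.
  rewrite big_split_ord/= mulmx_sum_row -big_split/=; apply: eq_bigr => i _.
  rewrite /w /x !(unsplitK (inl _)) !(unsplitK (inr _)) rowK scalerN -scalerBl.
  by congr (_ *: _); field.
apply: convex_set_sum => //.
- move=> k; rewrite /w; case: fintype.split => i; rewrite addr_ge0// divr_ge0//.
    by rewrite -lerBlDr sub0r ler_normr lexx orbT.
  by rewrite subr_ge0 ler_norm.
- rewrite (_ : \sum_k w k = \sum_(i < n) (w (lshift n i) + w (rshift n i))); last first.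
    by rewrite big_split_ord big_split.
  under eq_bigr => i _ do rewrite /w (unsplitK (inl _)) (unsplitK (inr _)).
  rewrite (eq_bigr (fun i => `|v 0 i| + 2 * e)) => [|i _]; last by field.
  rewrite big_split/= sumr_const card_ord /e -mulr_natr.
  by field; rewrite pnatr_eq0 -lt0n.
- move=> k; rewrite /x; case: fintype.split => i; apply: AB.
    by left; exists i.
  by right; exists i.
Qed.

Lemma lebesgue_conv_hull_simplex n (x : 'I_n.+1 -> 'rV[R]_n) :
  lebesgue_rV (conv_hull [set x i | i in setT]) =
  (`|\det (\matrix_i (x (lift ord0 i) - x ord0))|%:E *
    lebesgue_rV (corner_simplex n 1))%E.
Proof.
rewrite conv_hull_simplex; set M := \matrix_i _.
have cS := @compact_corner_simplex R n 1.
rewrite -lebesgue_rV_mulmx//.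
rewrite -(@lebesgue_rV_shift _ _ (- x ord0) [set v *m M | v in corner_simplex n 1]).
  congr lebesgue_rV; apply/seteqP; split => [_ [v Sv <-]|w [v Sv vw]]/=.
    by rewrite addrK; exists v.
  by exists v => //; rewrite vw subrK.
by apply: measurable_mx_compact; exact: compact_mulmx_image.
Qed.

Lemma lebesgue_conv_hull_crosspolytope n (y : 'I_n -> 'rV[R]_n) : (0 < n)%N ->
  lebesgue_rV (conv_hull ([set y i | i in setT] `|` [set - y i | i in setT])) =
  (`|\det (\matrix_i y i)|%:E * ((2 ^+ n)%:E * lebesgue_rV (corner_simplex n 1)))%E.
Proof.
move=> n0; rewrite conv_hull_crosspolytope// lebesgue_rV_mulmx.
  by rewrite lebesgue_crosspolytope.
exact: compact_crosspolytope.
Qed.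

End hulls.

(** * The two determinants; laws of independent rows *)

Section determinants.
Context {R : realType}.

Definition det_rows n (y : 'I_n -> 'rV[R]_n) : R := \det (\matrix_i y i).

Definition det_edges n (x : 'I_n.+1 -> 'rV[R]_n) : R :=
  \det (\matrix_i (x (lift ord0 i) - x ord0)).

Definition neg_head n (x : 'I_n.+1 -> 'rV[R]_n) i :=
  if i == ord0 then - x i else x i.

Let affine_mx n (x : 'I_n.+1 -> 'rV[R]_n) : 'M[R]_(1 + n) :=
  row_mx (const_mx 1 : 'cV_n.+1) (\matrix_i x i).

(** Subtracting the first row (1, x_0) from the others clears the column of
    ones. *)
Let det_affine_mx n (x : 'I_n.+1 -> 'rV[R]_n) : \det (affine_mx x) = det_edges x.
Proof.
pose E : 'M[R]_(1 + n) := block_mx 1%:M 0 (const_mx (-1)) 1%:M.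
have dE : \det E = 1 by rewrite det_lblock !det1 mulr1.
have -> : affine_mx x = block_mx 1%:M (x ord0) (const_mx 1) (\matrix_i x (lift ord0 i)).
  apply/matrixP => i j; rewrite /affine_mx.
  case: (split_ordP i) => i' ->; case: (split_ordP j) => j' ->.
  - by rewrite block_mxEul row_mxEl !mxE !ord1.
  - rewrite block_mxEur row_mxEr !mxE !ord1; congr (x _ _ _); exact: val_inj.
  - by rewrite block_mxEdl row_mxEl !mxE.
  - rewrite block_mxEdr row_mxEr !mxE; congr (x _ _ _); exact: val_inj.
rewrite -[LHS]mul1r -[X in X * _]dE -det_mulmx mulmx_block !mul1mx !mul0mx !addr0 mulmx1.
rewrite (_ : _ + const_mx 1 = 0); last first.
  by apply/matrixP => i j; rewrite !mxE addNr.
rewrite det_ublock det1 mul1r; congr determinant.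
by apply/matrixP => i j; rewrite !mxE big_ord1 !mxE mulN1r addrC.
Qed.

(** Expansion of the bordered determinant along its column of ones. *)
Lemma det_edges_le n (x : 'I_n.+1 -> 'rV[R]_n) :
  `|det_edges x| <= \sum_j `|det_rows (x \o lift j)|.
Proof.
rewrite -det_affine_mx (expand_det_col _ (lshift n 0)).
apply: le_trans (ler_norm_sum _ _ _) _; apply: ler_sum => j _.
rewrite {1}/affine_mx row_mxEl mxE mul1r /cofactor normrM normrX normrN1 expr1n mul1r.
rewrite le_eqVlt; apply/orP; left; apply/eqP; congr (`|\det _|).
apply/matrixP => i k; rewrite !mxE.
rewrite (_ : lift (lshift n 0) k = rshift 1 k); last by apply: val_inj.
by rewrite (unsplitK (inr k)) mxE.
Qed.

(** The bordered determinant is linear in its first row, and (1, 0) is the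
    average of (1, x_0) and (1, - x_0). *)
Lemma det_rows_average n (x : 'I_n.+1 -> 'rV[R]_n) :
  det_rows (x \o lift ord0) = 2^-1 * det_edges x + 2^-1 * det_edges (neg_head x).
Proof.
pose x0 i := if i == ord0 then 0 else x i.
have -> : det_rows (x \o lift ord0) = det_edges x0.
  by congr determinant; apply/matrixP => i j; rewrite !mxE /x0/= subr0.
rewrite -!det_affine_mx.
apply: (@determinant_multilinear _ _ _ _ _ ord0).
- apply/rowP => j; rewrite !mxE; case: fintype.split => k; rewrite !mxE.
    by field.
  by rewrite /x0 /neg_head/=; field.
- apply/matrixP => i j; rewrite !mxE; case: fintype.split => k; rewrite !mxE//.
- apply/matrixP => i j; rewrite !mxE; case: fintype.split => k; rewrite !mxE//.
Qed.

End determinants.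

Section joint_law.
Context {R : realType}.
Local Open Scope ereal_scope.

(** The X_i are independent with common law nu. Only the product rule over the
    full family is recorded: taking some A_i to be the whole space gives the
    subfamilies when nu has mass 1. *)
Definition product_law d (T : measurableType d) (P : probability T R) k n
    (nu : set 'rV[R]_n -> \bar R) (X : 'I_k -> T -> 'rV[R]_n) :=
  (forall i, measurable_fun setT (X i)) /\
  forall A : 'I_k -> set 'rV[R]_n, (forall i, measurable (A i)) ->
    P (\bigcap_i (X i @^-1` A i)) = \prod_i nu (A i).

Lemma measurable_rows d (T : measurableType d) k n (X : 'I_k -> T -> 'rV[R]_n) :
  (forall i, measurable_fun setT (X i)) ->
  measurable_fun setT (fun t => \matrix_i X i t).
Proof.
move=> mX; apply: measurable_mx_fun => i j.
under eq_fun do rewrite mxE.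
exact: (measurableT_comp (@measurable_mx_coord R 1 n 0%R j) (mX i)). 
Qed.

(** The product rule determines the joint law on boxes of matrices, hence
    everywhere. *)
Lemma product_law_integral k n (nu : set 'rV[R]_n -> \bar R)
    d (T : measurableType d) (P : probability T R) (X : 'I_k -> T -> 'rV[R]_n)
    d' (T' : measurableType d') (P' : probability T' R) (Y : 'I_k -> T' -> 'rV[R]_n)
    (g : 'M[R]_(k, n) -> \bar R) :
  product_law P nu X -> product_law P' nu Y ->
  measurable_fun setT g -> (forall M, 0 <= g M) ->
  \int[P]_t g (\matrix_i X i t) = \int[P']_t g (\matrix_i Y i t).
Proof.
move=> [mX XE] [mY YE] mg g0.
have mXr := measurable_rows mX; have mYr := measurable_rows mY.
pose FX : {mfun T >-> 'M[R]_(k, n)} :=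
  HB.pack (fun t => \matrix_i X i t) (@isMeasurableFun.Build _ _ _ _ _ mXr).
pose FY : {mfun T' >-> 'M[R]_(k, n)} :=
  HB.pack (fun t => \matrix_i Y i t) (@isMeasurableFun.Build _ _ _ _ _ mYr).
have boxE d1 (T1 : measurableType d1) (Z : 'I_k -> T1 -> 'rV[R]_n) a b :
    (fun t => \matrix_i Z i t) @^-1` mx_box a b =
    \bigcap_i (Z i @^-1` mx_box (row i a) (row i b)).
  apply/seteqP; split => t/= H.
    by move=> i _ u j; have := H i j; rewrite !mxE ord1.
  by move=> i j; have := H i I 0%R j; rewrite !mxE.
transitivity (\int[pushforward P FX]_M g M).
  by rewrite ge0_integral_pushforward.
transitivity (\int[pushforward P' FY]_M g M); last first.
  by rewrite ge0_integral_pushforward.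
apply: eq_measure_integral => A mA _.
apply: (@eq_measure_mx_box R k n (pushforward P FX) (pushforward P' FY)) => // a b.
- change (P ((fun t => \matrix_i X i t) @^-1` mx_box a b) =
          P' ((fun t => \matrix_i Y i t) @^-1` mx_box a b)).
  by rewrite !boxE XE ?YE// => i; exact: measurable_mx_box.
- rewrite /pushforward (le_lt_trans (probability_le1 _ _))// ?ltry//.
  by apply: measurable_preimageT => //; exact: measurable_mx_box.
Qed.

Lemma product_law_lift d (T : measurableType d) (P : probability T R) k n
    (nu : set 'rV[R]_n -> \bar R) (X : 'I_k.+1 -> T -> 'rV[R]_n) j :
  nu setT = 1 -> product_law P nu X -> product_law P nu (X \o lift j).
Proof.
move=> nu1 [mX XE]; split => [i|A mA]; first exact: mX.
pose B i := if unlift j i is Some i' then A i' else setT.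
have Bl i : B (lift j i) = A i by rewrite /B liftK.
have Bj : B j = setT by rewrite /B unlift_none.
have -> : \bigcap_i (X \o lift j) i @^-1` A i = \bigcap_i (X i @^-1` B i).
  apply/seteqP; split => t/= H i _.
    by case: (unliftP j i) => [i' ->|->]/=; rewrite ?Bl ?Bj//; exact: H.
  by have := H (lift j i) I; rewrite /= Bl.
rewrite XE => [|i]; last by case: (unliftP j i) => [i' ->|->]; rewrite ?Bl ?Bj.
rewrite (bigD1_ord j)//= Bj nu1 mul1e.
by apply: eq_bigr => i _; rewrite Bl.
Qed.

Lemma measurable_oppmx n : measurable_fun setT (fun v : 'rV[R]_n => - v)%R.
Proof.
apply: measurable_mx_fun => i j; under eq_fun do rewrite mxE.
by apply: measurableT_comp => //; exact: measurable_mx_coord.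
Qed.

(** Reflecting one factor of a product of symmetric laws gives the same
    product. *)
Lemma product_law_neg_head d (T : measurableType d) (P : probability T R) k n
    (nu : set 'rV[R]_n -> \bar R) (X : 'I_k.+1 -> T -> 'rV[R]_n) :
  (forall A : set 'rV[R]_n, measurable A ->
    nu [set v : 'rV[R]_n | A (- v)%R] = nu A) ->
  product_law P nu X ->
  product_law P nu (fun i t => if i == ord0 then - X i t else X i t)%R.
Proof.
move=> nuN [mX XE]; split => [i|A mA].
  case: eqP => _; last exact: mX.
  by apply: measurableT_comp (mX i); exact: measurable_oppmx.
pose B i := if i == ord0 then [set v : 'rV[R]_n | A i (- v)%R] else A i.
have mB i : measurable (B i).
  rewrite /B; case: eqP => // _.
  exact: (measurable_preimageT (@measurable_oppmx n)).
transitivity (P (\bigcap_i (X i @^-1` B i))).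
  congr (P _); apply: eq_bigcapr => i _; rewrite /B; by case: eqP.
rewrite XE//; apply: eq_bigr => i _; rewrite /B; case: eqP => // _.
exact: nuN.
Qed.

End joint_law.

(** * Comparison of convex moments of the determinants *)

Section moments.
Context {R : realType}.

(** The properties shared by Orlicz functions, powers and t |-> max(0, t - y), so
    that one comparison of moments serves all the norms. *)
Definition convex_gauge (psi : R -> R) :=
  [/\ (forall t, 0 <= t -> 0 <= psi t),
      {in `[0, +oo[ &, {homo psi : s t / s <= t}} &
      convex_function (`[0, +oo[%classic : set (convex_lmodType R^o)) psi].

Lemma convex_gauge_le psi s t : convex_gauge psi -> 0 <= s -> s <= t -> psi s <= psi t.
Proof.
move=> [_ npsi _] s0 st; apply: npsi => //; rewrite in_itv/= andbT//.
exact: le_trans st.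
Qed.

(** Jensen inequality, read off from the convexity of the epigraph. *)
Lemma convex_gauge_sum psi k (w t : 'I_k -> R) : convex_gauge psi ->
  (forall i, 0 <= w i) -> \sum_i w i = 1 -> (forall i, 0 <= t i) ->
  psi (\sum_i w i * t i) <= \sum_i w i * psi (t i).
Proof.
move=> [_ _ cpsi] w0 w1 t0.
pose epi : set (R^o * R^o) := [set p | 0 <= p.1 /\ psi p.1 <= p.2].
have cepi : convex_set (epi : set (convex_lmodType (R^o * R^o)%type)).
  move=> p q l; rewrite !inE => -[p0 pp] [q0 qq].
  have l0 : 0 <= l%:num by []. have l1 : 0 <= 1 - l%:num by rewrite subr_ge0.
  have pI (u : R) : 0 <= u -> u \in (`[0, +oo[%classic : set (convex_lmodType R^o)).
    by move=> u0; rewrite inE/= in_itv/= andbT.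
  split; first by rewrite addr_ge0// mulr_ge0.
  apply: le_trans (cpsi l _ _ (pI _ p0) (pI _ q0)) _.
  by apply: lerD; apply: ler_wpM2l.
have := @convex_set_sum R (R^o * R^o)%type epi k w (fun i => (t i, psi (t i)) : R^o * R^o)
  cepi w0 w1 (fun i => conj (t0 i) (lexx _)).
rewrite /epi/= !raddf_sum/= => -[_].
by under eq_bigr do rewrite /GRing.scale/=.
Qed.

Lemma convex_gauge_average psi s t : convex_gauge psi -> 0 <= s -> 0 <= t ->
  psi (2^-1 * s + 2^-1 * t) <= 2^-1 * psi s + 2^-1 * psi t.
Proof.
move=> gpsi s0 t0.
have := @convex_gauge_sum psi 2 (fun=> 2^-1) (fun i => if i == ord0 then s else t) gpsi.
rewrite !big_ord_recl !big_ord0/= !addr0; apply => //; first by field.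
by move=> i; case: eqP.
Qed.

(** A gauge is only controlled on the half-line, so it is first extended to the
    left by a constant, which makes it monotone on the whole line. *)
Lemma measurable_convex_gauge d (T : measurableType d) psi (f : T -> R) :
  convex_gauge psi -> measurable_fun setT f -> (forall t, 0 <= f t) ->
  measurable_fun setT (fun t => psi (f t)).
Proof.
move=> gpsi mf f0.
rewrite (_ : (fun t => _) = (fun u => psi (Num.max 0 u)) \o f); last first.
  by apply/funext => t /=; rewrite max_r.
apply: measurableT_comp => //; apply: nondecreasing_measurable => // u v uv.
apply: convex_gauge_le => //; first by rewrite le_max lexx.
by rewrite ge_max !le_max lexx uv orbT.
Qed.

Lemma measurable_det n : measurable_fun setT (fun M : 'M[R]_n => \det M).
Proof.
apply: measurable_sum => s; apply: measurable_funM => //.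
by apply: measurable_prod => i _; exact: measurable_mx_coord.
Qed.

Lemma measurable_det_rows n d (T : measurableType d) (Y : 'I_n -> T -> 'rV[R]_n) :
  (forall i, measurable_fun setT (Y i)) ->
  measurable_fun setT (fun t => det_rows (fun i => Y i t)).
Proof. by move=> mY; apply: measurableT_comp (measurable_rows mY); exact: measurable_det. Qed.

Lemma measurable_det_edges n d (T : measurableType d) (X : 'I_n.+1 -> T -> 'rV[R]_n) :
  (forall i, measurable_fun setT (X i)) ->
  measurable_fun setT (fun t => det_edges (fun i => X i t)).
Proof.
move=> mX; apply: (measurable_det_rows (Y := fun i t => X (lift ord0 i) t - X ord0 t)) => i.
apply: measurable_mx_fun => a b; under eq_fun do rewrite !mxE.
by apply: measurable_funB; exact: (measurableT_comp (measurable_mx_coord a b) (mX _)).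
Qed.

Local Open Scope ereal_scope.
Variables (n : nat) (nu : set 'rV[R]_n -> \bar R).
Hypothesis nu1 : nu setT = 1.
Hypothesis nuN : forall A : set 'rV[R]_n, measurable A ->
  nu [set v : 'rV[R]_n | A (- v)%R] = nu A.
Variables (d : measure_display) (T : measurableType d) (P : probability T R)
  (X : 'I_n.+1 -> T -> 'rV[R]_n).
Hypothesis X_law : product_law P nu X.
Variables (d' : measure_display) (T' : measurableType d') (P' : probability T' R)
  (Y : 'I_n -> T' -> 'rV[R]_n).
Hypothesis Y_law : product_law P' nu Y.
Variables (psi : R -> R) (a : R).
Hypotheses (psi_gauge : convex_gauge psi) (a0 : (0 <= a)%R).

Let IY := \int[P']_t (psi (a * `|det_rows (fun i => Y i t)|))%:E.
Let IX := \int[P]_t (psi (a * `|det_edges (fun i => X i t)|))%:E.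

Let scaled_norm_ge0 (x : R) : (0 <= a * `|x|)%R. Proof. by rewrite mulr_ge0. Qed.
Let psi_norm_ge0 (x : R) : (0 <= psi (a * `|x|))%R.
Proof. by case: psi_gauge => p0 _ _; exact: p0. Qed.

Let measurable_psi_norm d1 (T1 : measurableType d1) (f : T1 -> R) :
  measurable_fun setT f -> measurable_fun setT (fun t => (psi (a * `|f t|))%:E).
Proof.
move=> mf; apply/measurable_EFinP; apply: measurable_convex_gauge => //.
by apply: measurable_funM => //; exact: measurableT_comp.
Qed.

Let IYE j : \int[P]_t (psi (a * `|det_rows (fun i => X (lift j i) t)|))%:E = IY.
Proof.
apply: (product_law_integral (g := fun M => (psi (a * `|\det M|))%:E)
  (product_law_lift j nu1 X_law) Y_law) => [|M]; last by rewrite lee_fin.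
by apply: measurable_psi_norm; exact: measurable_det.
Qed.

(** Changing the sign of the first point preserves the joint law, and the
    determinant of the other n points is the average of the two determinants
    of edges so obtained; convexity concludes. *)
Lemma det_rows_moment_le : IY <= IX.
Proof.
have [mX _] := X_law.
have X'_law := product_law_neg_head nuN X_law.
have [mX' _] := X'_law.
have IX' : \int[P]_t (psi (a * `|det_edges (neg_head (fun i => X i t))|))%:E = IX.
  pose g (M : 'M[R]_(n.+1, n)) := (psi (a * `|det_edges (fun i => row i M)|))%:E.
  have gE d1 (T1 : measurableType d1) (Z : 'I_n.+1 -> T1 -> 'rV[R]_n) t :
      g (\matrix_i Z i t) = (psi (a * `|det_edges (fun i => Z i t)|))%:E.
    by rewrite /g; under eq_fun do rewrite rowK.
  have mg : measurable_fun setT g.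
    apply: measurable_psi_norm; apply: measurable_det_edges => i.
    apply: measurable_mx_fun => u v; under eq_fun do rewrite mxE.
    exact: measurable_mx_coord.
  have g0 M : 0 <= g M by rewrite lee_fin.
  have E := product_law_integral X'_law X_law mg g0.
  transitivity (\int[P]_t g (\matrix_i (if i == ord0 then - X i t else X i t)%R)).
    apply: eq_integral => t _; apply/esym.
    exact: (gE _ _ (fun i t => neg_head (fun i => X i t) i) t).
  by rewrite E; apply: eq_integral => t _; exact: gE.
rewrite -(IYE ord0).
apply: (@le_trans _ _ (\int[P]_t
   (2^-1%:E * (psi (a * `|det_edges (fun i => X i t)|))%:E +
    2^-1%:E * (psi (a * `|det_edges (neg_head (fun i => X i t))|))%:E))).
  apply: ge0_le_integral => //.
  - by move=> t _; rewrite lee_fin.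
  - by apply: measurable_psi_norm; exact: measurable_det_rows.
  - apply: emeasurable_funD; apply: measurable_funeM; apply: measurable_psi_norm.
      exact: measurable_det_edges.
    exact: (measurable_det_edges mX').
  move=> t _; rewrite -!EFinM -EFinD lee_fin.
  apply: le_trans (convex_gauge_average psi_gauge (scaled_norm_ge0 _) (scaled_norm_ge0 _)).
  apply: convex_gauge_le => //.
  rewrite (det_rows_average (fun i => X i t)).
  rewrite !(mulrCA _ a) -[leRHS]mulrDr ler_wpM2l// (le_trans (ler_normD _ _))//.
  by rewrite !normrM (@ger0_norm _ 2^-1%R).
rewrite ge0_integralD//; last 4 first.
- by move=> t _; rewrite mule_ge0// lee_fin.
- by apply: measurable_funeM; apply: measurable_psi_norm; exact: measurable_det_edges.
- by move=> t _; rewrite mule_ge0// lee_fin.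
- apply: measurable_funeM; apply: measurable_psi_norm.
  exact: (measurable_det_edges mX').
rewrite !ge0_integralZl//; last 4 first.
- by apply: measurable_psi_norm; exact: (measurable_det_edges mX').
- by move=> t _; rewrite lee_fin.
- by apply: measurable_psi_norm; exact: measurable_det_edges.
- by move=> t _; rewrite lee_fin.
rewrite IX' -/IX -ge0_muleDl// -EFinD.
by rewrite (_ : 2^-1 + 2^-1 = 1)%R ?mul1e//; field.
Qed.

(** The determinant of edges is at most a sum of n + 1 determinants, all with the
    law of that of the Y_i; convexity is applied to their average. *)
Lemma det_edges_moment_le :
  \int[P]_t (psi (n.+1%:R^-1 * (a * `|det_edges (fun i => X i t)|)))%:E <= IY.
Proof.
have [mX _] := X_law; have n0 : (0 <= n.+1%:R^-1 :> R)%R by rewrite invr_ge0.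
apply: (@le_trans _ _ (\int[P]_t \sum_(j < n.+1)
    (n.+1%:R^-1)%:E * (psi (a * `|det_rows (fun i => X (lift j i) t)|))%:E)).
  apply: ge0_le_integral => //.
  - by move=> t _; rewrite lee_fin; case: psi_gauge => + _ _; apply; rewrite mulr_ge0.
  - apply/measurable_EFinP; apply: measurable_convex_gauge => //.
      apply: measurable_funM => //; apply: measurable_funM => //.
      by apply: measurableT_comp => //; exact: measurable_det_edges.
    by move=> t; rewrite mulr_ge0.
  - apply: emeasurable_sum => j; apply: measurable_funeM; apply: measurable_psi_norm.
    exact: measurable_det_rows.
  move=> t _; under eq_bigr do rewrite -EFinM.
  rewrite sumEFin lee_fin.
  apply: le_trans (convex_gauge_sum psi_gauge _ _ _) => //.
    apply: convex_gauge_le => //; first by rewrite mulr_ge0.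
    rewrite -mulr_sumr ler_wpM2l// -mulr_sumr ler_wpM2l//.
    exact: det_edges_le.
  by rewrite sumr_const card_ord -[LHS]mulr_natr mulVf// pnatr_eq0.
rewrite ge0_integral_sum//; last 2 first.
- move=> j; apply: measurable_funeM; apply: measurable_psi_norm.
  exact: measurable_det_rows.
- by move=> j t _; rewrite mule_ge0// lee_fin.
under eq_bigr => j _.
  rewrite ge0_integralZl//; last 2 first.
  - by apply: measurable_psi_norm; exact: measurable_det_rows.
  - by move=> t _; rewrite lee_fin.
  rewrite IYE; over.
rewrite /= -ge0_sume_distrl => [|j _]; last by rewrite lee_fin.
by rewrite sumEFin sumr_const card_ord -[X in X%:E]mulr_natr mulVf ?mul1e//.
Qed.

End moments.

(** * From convex moments to Orlicz and Lebesgue norms *)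

Section norm_comparison.
Context {R : realType}.

Lemma convex_gauge_scale (psi : R -> R) c : convex_gauge psi -> 0 <= c ->
  convex_gauge (fun t => psi (c * t)).
Proof.
move=> gpsi c0; case: (gpsi) => p0 _ cpsi; split.
- by move=> t t0; apply: p0; rewrite mulr_ge0.
- move=> s t; rewrite !in_itv/= !andbT => s0 t0 st.
  by apply: convex_gauge_le => //; [rewrite mulr_ge0|rewrite ler_wpM2l].
- have cI (u : R) : u \in (`[0, +oo[%classic : set (convex_lmodType R^o)) ->
    c * u \in (`[0, +oo[%classic : set (convex_lmodType R^o)).
    by rewrite !inE/= !in_itv/= !andbT => u0; rewrite mulr_ge0.
  move=> l s t s0 t0; apply: le_trans (cpsi l _ _ (cI _ s0) (cI _ t0)).
  rewrite le_eqVlt; apply/orP; left; apply/eqP; congr psi.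
  change (c * (l%:num * s + (1 - l%:num) * t) =
    l%:num * (c * s) + (1 - l%:num) * (c * t)).
  by ring.
Qed.

Lemma convex_gauge_orlicz (psi : R -> R) : orlicz_function psi -> convex_gauge psi.
Proof. by move=> [[p0 _ npsi] cpsi _ _]. Qed.

Lemma convex_gauge_powR (p : R) : 1 <= p -> convex_gauge (fun t : R => t `^ p).
Proof.
move=> p1; split.
- by move=> t _; exact: powR_ge0.
- move=> s t; rewrite !in_itv/= !andbT => s0 t0 st.
  by apply: ge0_ler_powR => //; exact: le_trans p1.
- exact: convex_powR.
Qed.

(** This gauge has moment zero exactly when the variable is almost surely at
    most y, which is how the essential supremum is reached. *)
Lemma convex_gauge_excess (y : R) : convex_gauge (fun t => Num.max 0 (t - y)).
Proof.
split.
- by move=> t _; rewrite le_max lexx.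
- by move=> s t _ _ st; rewrite ge_max !le_max lexx/= lerB ?orbT.
move=> l s t _ _.
change (Num.max 0 (l%:num * s + (1 - l%:num) * t - y) <=
  l%:num * Num.max 0 (s - y) + (1 - l%:num) * Num.max 0 (t - y)).
have l0 : 0 <= l%:num by []. have l1 : 0 <= 1 - l%:num by rewrite subr_ge0.
rewrite ge_max; apply/andP; split.
  by rewrite addr_ge0// mulr_ge0// le_max lexx.
rewrite (_ : _ - y = l%:num * (s - y) + (1 - l%:num) * (t - y)); last by ring.
by apply: lerD; apply: ler_wpM2l => //; rewrite le_max lexx orbT.
Qed.

Local Open Scope ereal_scope.
Variables (d : measure_display) (T : measurableType d) (P : probability T R) (f : T -> R).
Variables (d' : measure_display) (T' : measurableType d') (P' : probability T' R) (g : T' -> R).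
Variable c : R.
Hypotheses (c0 : (0 < c)%R) (f0 : forall t, (0 <= f t)%R) (g0 : forall t, (0 <= g t)%R).
Hypotheses (mf : measurable_fun setT f) (mg : measurable_fun setT g).
Hypothesis fg : forall psi, convex_gauge psi ->
  \int[P]_t (psi (c^-1 * f t)%R)%:E <= \int[P']_t (psi (g t))%:E.

Lemma orlicz_norm_le psi : orlicz_function psi ->
  orlicz_norm P psi f <= c%:E * orlicz_norm P' psi g.
Proof.
move=> /convex_gauge_orlicz gpsi; rewrite -lee_pdivrMl//.
apply: le_ereal_inf_tmp => _ [rho [rho0 Erho] <-].
rewrite lee_pdivrMl//; apply: ereal_inf_lbound.
exists (c * rho)%R => //; split; first by rewrite mulr_gt0.
apply: le_trans Erho; rewrite unlock.
have := fg (convex_gauge_scale gpsi (ltW (_ : 0 < rho^-1)%R)).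
rewrite invr_gt0 => /(_ rho0); congr (_ <= _); apply: eq_integral => t _.
- rewrite ger0_norm//; congr (psi _)%:E; rewrite invfM mulrA mulrC; congr (_ * _)%R; exact: mulrC.
- by rewrite ger0_norm// mulrC.
Qed.

(** For finite p the gauge is t |-> (c t)^p. For p = +oo the gauge max(0, t - y),
    with y the essential supremum of g, has moment zero at g, hence at f / c. *)
Lemma Lnorm_le p : 1 <= p -> 'N[P]_p[EFin \o f] <= c%:E * 'N[P']_p[EFin \o g].
Proof.
case: p => [p||//] p1.
  rewrite lee_fin in p1; have p0 : (0 < p)%R := lt_le_trans ltr01 p1.
  have fgp := fg (convex_gauge_scale (convex_gauge_powR p1) (ltW c0)).
  rewrite unlock.
  have -> : \int[P]_t `|(EFin \o f) t| `^ p = \int[P]_t ((c * (c^-1 * f t)) `^ p)%R%:E.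
    apply: eq_integral => t _ /=; rewrite ger0_norm//.
    by rewrite mulrA mulfV ?gt_eqF// mul1r.
  have E : \int[P']_t ((c * g t) `^ p)%R%:E =
      (c `^ p)%:E * \int[P']_t `|(EFin \o g) t| `^ p.
    rewrite -ge0_integralZl//.
    - by apply: eq_integral => t _ /=; rewrite powRM ?(ltW c0)// ger0_norm.
    - apply/measurable_EFinP; apply: (measurable_convex_gauge (convex_gauge_powR p1)) => //.
      exact: measurableT_comp.
    - by move=> t _; rewrite poweR_ge0.
    - by rewrite lee_fin powR_ge0.
  have pV0 : (0 <= p^-1)%R by rewrite invr_ge0 ltW.
  apply: (@le_trans _ _ ((\int[P']_t ((c * g t) `^ p)%R%:E) `^ p^-1)).
    apply: gt0_ler_poweR => //; rewrite ?in_itv/= ?leey ?andbT.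
    - by apply: integral_ge0 => t _; rewrite lee_fin powR_ge0.
    - by apply: integral_ge0 => t _; rewrite lee_fin powR_ge0.
  rewrite E poweRM ?lee_fin ?powR_ge0//; last first.
    by apply: integral_ge0 => t _; rewrite poweR_ge0.
  by rewrite poweR_EFin -powRrM mulfV ?gt_eqF// powRr1// ltW.
have P1 : 0 < P setT by rewrite probability_setT.
have P'1 : 0 < P' setT by rewrite probability_setT.
rewrite unlock P1 P'1.
set e := ess_sup_inf.ess_sup P' _.
have e0 : 0 <= e.
  by have := Lnorm_ge0 P' +oo (EFin \o g); rewrite unlock P'1.
case Ee : e e0 => [y| |] // e0; last by rewrite gt0_muley ?lte_fin// leey.
have ge : \forall t \ae P', (abse \o (EFin \o g)) t <= y%:E.
  by rewrite -Ee; exact: ess_sup_inf.ess_sup_ge.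
have gpsi := convex_gauge_excess y.
have If : \int[P]_t (Num.max 0 (c^-1 * f t - y))%R%:E = 0.
  apply/eqP; rewrite eq_le; apply/andP; split; last first.
    by apply: integral_ge0 => t _; rewrite lee_fin le_max lexx.
  apply: le_trans (fg gpsi) _.
  rewrite (ae_eq_integral (cst 0)) ?integral0//.
    apply/measurable_EFinP.
    exact: (measurable_convex_gauge gpsi).
  apply: filterS ge => t /=; rewrite lee_fin ger0_norm// => gy _.
  by rewrite max_l// subr_le0.
rewrite -EFinM; apply/ess_sup_inf.ess_supP.
have mF : measurable_fun setT (fun t => (Num.max 0 (c^-1 * f t - y))%R%:E).
  apply/measurable_EFinP; apply: (measurable_convex_gauge gpsi).
    exact: measurable_funM.
  by move=> t; rewrite mulr_ge0// invr_ge0 ltW.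
have /(ae_eq_integral_abs P measurableT mF) : \int[P]_t `|(Num.max 0 (c^-1 * f t - y))%R%:E| = 0.
  rewrite -[RHS]If; apply: eq_integral => t _ /=.
  by rewrite ger0_norm// le_max lexx.
apply: filterS => t /(_ I) /= [] /eqP.
rewrite lee_fin ger0_norm// eq_le ge_max lexx/= => /andP[].
by rewrite subr_le0 ler_pdivrMl.
Qed.

End norm_comparison.

(** * Uniform points in a symmetric convex body *)

Section uniform_law.
Context {R : realType}.
Local Open Scope ereal_scope.

Definition uniform_law n (K : set 'rV[R]_n) (A : set 'rV[R]_n) : \bar R :=
  lebesgue_rV (A `&` K) / lebesgue_rV K.

Lemma product_law_iid d (T : measurableType d) (P : probability T R) k n
    (K : set 'rV[R]_n) (X : 'I_k -> {RV P >-> 'rV[R]_n}) :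
  iid_uniform_on K X -> product_law P (uniform_law K) X.
Proof.
move=> [indX uX]; split => [i|A mA]; first exact: measurable_funPT.
have := indX [set: 'I_k]%SET A (fun i _ => mA i).
rewrite (_ : \bigcap_(i in _) _ = \bigcap_i (X i @^-1` A i)); last first.
  by apply/seteqP; split => t H i _; apply: H => //=; rewrite inE.
move=> ->; apply: eq_big => [i|i _]; first by rewrite inE.
exact: uX.
Qed.

Lemma lebesgue_rV_opp n (A : set 'rV[R]_n) : measurable A ->
  lebesgue_rV [set v : 'rV[R]_n | A (- v)%R] = lebesgue_rV A.
Proof.
move=> mA.
have := @scales_unit R n (-1)%:M _ A mA.
rewrite unitmxE det_scalar unitrX ?unitrN1// => /(_ isT).
rewrite normrX normrN1 expr1n invr1 mul1e => <-.
by congr lebesgue_rV; apply/funext => v /=; rewrite mul_mx_scalar scaleN1r.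
Qed.

Lemma uniform_law_opp n (K A : set 'rV[R]_n) : measurable K -> symmetric_set K ->
  measurable A -> uniform_law K [set v : 'rV[R]_n | A (- v)%R] = uniform_law K A.
Proof.
move=> mK symK mA; rewrite /uniform_law -(lebesgue_rV_opp (measurableI _ _ mA mK)).
congr (lebesgue_rV _ / _); apply/seteqP; split => v /= [Av Kv]; split => //.
  by rewrite -symK; exists v.
by rewrite -[v]opprK -symK; exists (- v)%R.
Qed.

Lemma lebesgue_rV_fine_ge0 n (A : set 'rV[R]_n) : (0 <= fine (lebesgue_rV A))%R.
Proof. by apply: fine_ge0; exact: lebesgue_rV_ge0. Qed.

(** The constant factor between volumes, relative to K, and determinants. *)
Definition simplex_ratio n (K : set 'rV[R]_n) : R :=
  (fine (lebesgue_rV (@corner_simplex R n 1)) / fine (lebesgue_rV K))%R.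

Lemma simplex_ratio_ge0 n (K : set 'rV[R]_n) : (0 <= simplex_ratio K)%R.
Proof. by rewrite divr_ge0 ?lebesgue_rV_fine_ge0. Qed.

Lemma U_KE n (K : set 'rV[R]_n) d (T : measurableType d) (P : probability T R)
    (X : 'I_n.+1 -> {RV P >-> 'rV[R]_n}) t :
  U_K K X t = (simplex_ratio K * `|det_edges (fun i => X i t)|)%R.
Proof.
rewrite /U_K lebesgue_conv_hull_simplex fineM//; last first.
  by rewrite ge0_fin_numE ?lebesgue_corner_simplex_lty.
by rewrite /= mulrC mulrA mulrC mulrA.
Qed.

Lemma V_KE n (K : set 'rV[R]_n) d (T : measurableType d) (P : probability T R)
    (Y : 'I_n -> {RV P >-> 'rV[R]_n}) t : (0 < n)%N ->
  V_K K Y t = (2 ^+ n * (simplex_ratio K * `|det_rows (fun i => Y i t)|))%R.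
Proof.
move=> n0; have fS : lebesgue_rV (@corner_simplex R n 1) \is a fin_num.
  by rewrite ge0_fin_numE ?lebesgue_corner_simplex_lty.
rewrite /V_K lebesgue_conv_hull_crosspolytope// fineM// ?fin_numM// fineM//=.
by rewrite /simplex_ratio /det_rows; ring.
Qed.

Lemma poweR_root_le n (x y : \bar R) (c : R) : (0 < n)%N -> (0 <= c)%R -> 0 <= x -> 0 <= y ->
  y <= (c%:E * x) -> y `^ n%:R^-1 <= (c `^ n%:R^-1)%:E * x `^ n%:R^-1.
Proof.
move=> n0 c0 x0 y0 yx; rewrite -poweR_EFin -poweRM ?lee_fin//.
apply: gt0_ler_poweR => //; rewrite ?invr_ge0 ?in_itv/= ?leey ?andbT//.
by rewrite mule_ge0.
Qed.

End uniform_law.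

Section root_comparison.
Context {R : realType}.

Lemma root_exprn n (x : R) : (0 < n)%N -> 0 <= x -> (x ^+ n) `^ n%:R^-1 = x.
Proof.
move=> n0 x0; rewrite -powR_mulrn// -powRrM mulfV ?powRr1//.
by rewrite pnatr_eq0 -lt0n.
Qed.

Local Open Scope ereal_scope.

(** The n-th root turns the factors 2^n and 2^n / (n + 1) into those of the
    theorem. *)
Lemma root_bounds n (u v : \bar R) : (0 < n)%N -> 0 <= u -> 0 <= v ->
  v <= (2 ^+ n)%:E * u -> u <= (n.+1%:R / 2 ^+ n)%:E * v ->
  (2 / n.+1%:R `^ n%:R^-1)%:E * u `^ n%:R^-1 <= v `^ n%:R^-1 /\
  v `^ n%:R^-1 <= 2%:E * u `^ n%:R^-1.
Proof.
move=> n0 u0 v0 vu uv; split; last first.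
  have := @poweR_root_le R n u v (2 ^+ n)%R n0 _ u0 v0 vu.
  by rewrite root_exprn//; apply; rewrite exprn_ge0.
have n1 : (0 < n.+1%:R `^ n%:R^-1 :> R)%R by rewrite powR_gt0.
have := @poweR_root_le R n v u (n.+1%:R / 2 ^+ n)%R n0 _ v0 u0 uv.
rewrite divr_ge0 ?exprn_ge0// => /(_ isT).
rewrite powRM ?invr_ge0 ?exprn_ge0// -exprVn root_exprn ?invr_ge0//.
set r := (_ `^ _)%R in n1 *.
rewrite -[(2 / r)%R]invrK invfM invrK lee_pdivrMl; last by rewrite mulr_gt0.
by rewrite mulrC.
Qed.

End root_comparison.

Theorem proposition2 (R : realType) (n : nat) (n_ge1 : (1 <= n)%N)
    (K : set 'rV[R]_n) (K_body : convex_body K) (K_sym : symmetric_set K)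
    (d : measure_display) (T : measurableType d) (P : probability T R)
    (X : 'I_n.+1 -> {RV P >-> 'rV[R]_n}) (X_iid : iid_uniform_on K X)
    (d' : measure_display) (T' : measurableType d') (P' : probability T' R)
    (Y : 'I_n -> {RV P' >-> 'rV[R]_n}) (Y_iid : iid_uniform_on K Y) :
  (forall psi : R -> R, orlicz_function psi ->
    ((2 / n.+1%:R `^ n%:R^-1)%:E * orlicz_norm P psi (U_K K X) `^ n%:R^-1
       <= orlicz_norm P' psi (V_K K Y) `^ n%:R^-1)%E /\
    (orlicz_norm P' psi (V_K K Y) `^ n%:R^-1
       <= 2%:E * orlicz_norm P psi (U_K K X) `^ n%:R^-1)%E) /\
  (forall p : \bar R, (1%:E <= p)%E ->
    ((2 / n.+1%:R `^ n%:R^-1)%:E * 'N[P]_p[EFin \o U_K K X] `^ n%:R^-1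
       <= 'N[P']_p[EFin \o V_K K Y] `^ n%:R^-1)%E /\
    ('N[P']_p[EFin \o V_K K Y] `^ n%:R^-1
       <= 2%:E * 'N[P]_p[EFin \o U_K K X] `^ n%:R^-1)%E).
Proof.
case: K_body => _ /measurable_mx_compact mK _.
have X_law := product_law_iid X_iid; have Y_law := product_law_iid Y_iid.
pose nu := uniform_law K.
have nuN A (mA : measurable A) := uniform_law_opp mK K_sym mA.
have nu1 : (nu setT = 1)%E.
  rewrite /nu /uniform_law; case: X_iid => _ /(_ ord0 setT measurableT) <-.
  exact: (probability_setT (distribution P (X ord0))).
pose a := simplex_ratio K.
have a0 : 0 <= a := simplex_ratio_ge0 K.
have pow_gt0 : 0 < 2 ^+ n :> R by rewrite exprn_gt0.
have ratio_gt0 : 0 < n.+1%:R / 2 ^+ n :> R by rewrite divr_gt0.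
have UE := @U_KE R n K d T P X.
have VE t := @V_KE R n K d' T' P' Y t n_ge1.
have U0 t : 0 <= U_K K X t by rewrite UE mulr_ge0.
have V0 t : 0 <= V_K K Y t.
  by rewrite VE; apply: mulr_ge0; [exact: ltW|exact: mulr_ge0].
have mU : measurable_fun setT (U_K K X).
  rewrite (funext UE).
  apply: measurable_funM => //; apply: measurableT_comp => //.
  by apply: measurable_det_edges => i; exact: measurable_funPT.
have mV : measurable_fun setT (V_K K Y).
  rewrite (funext VE).
  apply: measurable_funM => //; apply: measurable_funM => //.
  apply: measurableT_comp => //.
  by apply: measurable_det_rows => i; exact: measurable_funPT.
have VU psi : convex_gauge psi ->
    (\int[P']_t (psi ((2 ^+ n)^-1 * V_K K Y t))%:E <= \int[P]_t (psi (U_K K X t))%:E)%E.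
  move=> gpsi; have := det_rows_moment_le nu1 nuN X_law Y_law gpsi a0.
  congr (_ <= _)%E; apply: eq_integral => t _; last by rewrite UE.
  by rewrite VE mulKf ?gt_eqF.
have UV psi : convex_gauge psi ->
    (\int[P]_t (psi ((n.+1%:R / 2 ^+ n)^-1 * U_K K X t))%:E <=
     \int[P']_t (psi (V_K K Y t))%:E)%E.
  move=> gpsi.
  have a0' : 0 <= 2 ^+ n * a by apply: mulr_ge0; [exact: ltW|].
  have := det_edges_moment_le nu1 X_law Y_law gpsi a0'.
  congr (_ <= _)%E; apply: eq_integral => t _; last by rewrite VE mulrA.
  by rewrite UE invf_div; congr (psi _)%:E; rewrite /a; ring.
split => [psi psiO|p p1]; apply: root_bounds => //.
- by apply: le_ereal_inf_tmp => _ [rho [rho0 _] <-]; rewrite lee_fin ltW.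
- by apply: le_ereal_inf_tmp => _ [rho [rho0 _] <-]; rewrite lee_fin ltW.
- exact: orlicz_norm_le.
- exact: orlicz_norm_le.
- exact: Lnorm_ge0.
- exact: Lnorm_ge0.
- exact: Lnorm_le.
- exact: Lnorm_le.
Qed.
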